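(* Consider the Gaussian nonparametric indirect regression (NPIR) model with known operator $T$, $$Y_{1i}=Th(X_i)+u_i,\quad u_i|X_i\sim N(0,\sigma^2(X_i)),\quad i=1,\dots,n,\qquad \inf_x\sigma^2(x)\ge\sigma_0^2>0,$$ with a random sample $\{(Y_{1i},X_i)\}_{i=1}^n$, and suppose there is a $\varsigma>0$ such that $\|Th\|_{L^2(X)}\lesssim\|h\|_{B^{-\varsigma}_{2,2}}$ for all $h\in B(p,L)$. Then $$\liminf_{n\to\infty}\inf_{\widetilde h_n}\sup_{h\in B(p,L)}\mathbb P_h\left(\|h-\widetilde h_n\|_\infty\ge c(n/\log n)^{-p/(2(p+\varsigma)+d)}\right)\ge c'>0,$$ where $\inf_{\widetilde h_n}$ denotes the infimum over all estimators based on the sample of size $n$, and the finite positive constants $c,c'$ depend only on $p,L,d,\varsigma$ and $\sigma_0$.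
   Context: $Y_2$ is a random vector with support $[0,1]^d$, $X$ is a random vector, and $T:L^2(Y_2)\to L^2(X)$, $Th(x)=E[h(Y_2)|X=x]$, is the conditional expectation operator, which is assumed known. $\mathbb P_h$ denotes probability under the NPIR model when the unknown function is $h$. $B^{s}_{q,q}$ denotes the Besov space of smoothness $s$ on $[0,1]^d$ with its usual norm $\|\cdot\|_{B^s_{q,q}}$; $B(p,L)=\{h\in B^p_{\infty,\infty}([0,1]^d):\|h\|_{B^p_{\infty,\infty}}\le L\}$ is the Hölder ball of smoothness $p>0$ and radius $0<L<\infty$. The relation $\|Th\|_{L^2(X)}\lesssim\|h\|_{B^{-\varsigma}_{2,2}}$ for all $h\in B(p,L)$ means that the inequality holds up to a finite positive constant uniform over $h\in B(p,L)$. $\|\cdot\|_\infty$ is the sup norm.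
   Formalization: The constant c may also depend on the constant C in ‖Th‖ ≤ C‖h‖; c' does not. Uniformity of c in C is false: for X uniform on the circle and Y_2 = X + wrapped Laplace noise of scale 1/K (ς=2, C~K²), c must tend to 0 as K grows. *)

(* Defs.v *)
From HB Require Import structures.
From mathcomp Require Import all_boot all_order all_algebra.
From mathcomp Require Import all_classical all_reals all_analysis.
From mathcomp Require Import measurable_realfun.

Set Implicit Arguments.
Unset Strict Implicit.
Unset Printing Implicit Defensive.

Import Order.TTheory GRing.Theory Num.Theory.
Import numFieldNormedType.Exports.

Local Open Scope classical_set_scope.
Local Open Scope ring_scope.

(* R^n is 'rV[R]_n, with the sigma-algebra generated by its coordinates (which
   is the Borel one, the topology of 'rV[R]_n being that of the max norm). *)
Definition rV_display : measure_display.
Proof. exact: default_measure_display. Qed.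

Section measurable_rV.
Context (R : realType) (n : nat).

Let coord : 'I_n -> 'rV[R]_n -> R := fun i v => v ord0 i.

Let rV_set0 : g_sigma_preimage coord set0.
Proof. exact: sigma_algebra0. Qed.

Let rV_setC A : g_sigma_preimage coord A -> g_sigma_preimage coord (~` A).
Proof. exact: sigma_algebraC. Qed.

Let rV_bigcup (F : (set 'rV[R]_n)^nat) :
  (forall i, g_sigma_preimage coord (F i)) ->
  g_sigma_preimage coord (\bigcup_i (F i)).
Proof. exact: sigma_algebra_bigcup. Qed.

HB.instance Definition _ := @isMeasurable.Build rV_display
  'rV[R]_n (g_sigma_preimage coord) rV_set0 rV_setC rV_bigcup.

End measurable_rV.

Section product_probability.
Context d (T : measurableType d) (R : realType).

Definition tcons n (z : T * n.-tuple T) : n.+1.-tuple T :=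
  [the n.+1.-tuple T of z.1 :: z.2].

Lemma measurable_tcons n : measurable_fun [set: T * n.-tuple T] (@tcons n).
Proof.
exact: (measurable_cons (f := fst) (g := snd)).
Qed.

HB.instance Definition _ n :=
  isMeasurableFun.Build _ _ _ _ (@tcons n) (@measurable_tcons n).

(* The n-fold product of P, i.e. the law of an i.i.d. sample of size n. *)
Fixpoint iid (P : probability T R) n : probability (n.-tuple T) R :=
  match n with
  | 0 => \d_([tuple] : 0.-tuple T)
  | n'.+1 => distribution (P \x iid P n')%E (@tcons n')
  end.

End product_probability.

Section cube.
Context (R : realType) (d : nat).

Definition cube : set 'rV[R]_d := [set y | forall i, 0 <= y ord0 i <= 1].

Definition row_of_tuple (t : d.-tuple (measurableTypeR R)) : 'rV[R]_d :=
  \row_i (tnth t i : R).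

Lemma measurable_row_of_tuple : measurable_fun setT row_of_tuple.
Proof.
apply: measurability => //= _ [B + <-].
rewrite -bigcup_seq => -[i /= _ [C mC <-]].
rewrite !setTI -comp_preimage.
rewrite (_ : _ \o _ = (tnth (T := measurableTypeR R))^~ i); last first.
  by apply/funext => t /=; rewrite mxE.
by rewrite -[X in measurable X]setTI; exact: measurable_tnth.
Qed.

HB.instance Definition _ :=
  isMeasurableFun.Build _ _ _ _ row_of_tuple measurable_row_of_tuple.

(* Lebesgue measure on [0,1]^d, seen as a measure on R^d carried by the cube. *)
Definition lebesgue_cube : probability 'rV[R]_d R :=
  distribution (iid (uniform_prob (@ltr01 R)) d) row_of_tuple.

End cube.

(* Functions on [0,1]^d are represented by functions on R^d; none of the
   norms below depends on their values outside the cube. *)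
Section besov.
Context (R : realType) (d : nat).
Implicit Types (f g h : 'rV[R]_d -> R) (r : nat) (s t : R) (q : \bar R).

Local Open Scope ereal_scope.

Definition fdiff r (v : 'rV[R]_d) f (y : 'rV[R]_d) : R :=
  (\sum_(k < r.+1) (-1) ^+ (r - k) * 'C(r, k)%:R * f (y + k%:R *: v))%R.

(* The r-th modulus of smoothness of f in L^q([0,1]^d): the r-th difference of
   step v is only considered at the points y with [y, y + r v] in the cube. *)
Definition modulus r q f t : \bar R :=
  ereal_sup
    [set 'N[lebesgue_cube R d]_q
           [(fun y => (\1_[set y | cube y /\ cube (y + r%:R *: v)%R] y
                       * fdiff r v f y)%:E)]
    | v in [set v : 'rV[R]_d | (`|v| <= t)%R]].

(* The norm of B^s_{q,q}([0,1]^d), for s > 0 and 1 <= q <= +oo, with moduli of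
   smoothness of order floor(s) + 1; in particular B^s_{oo,oo} is a
   Hoelder-Zygmund space. *)
Definition besov_pos_norm s q f : \bar R :=
  let w := modulus (Num.truncn s).+1 q f in
  'N[lebesgue_cube R d]_q[EFin \o f] +
  match q with
  | q'%:E =>
      (\int[lebesgue_measure]_(t in `]0%R, 1%R[)
        (((t `^ (- s))%:E * w t) `^ q' * (t^-1)%:E)) `^ q'^-1
  | _ => ereal_sup [set (t `^ (- s))%:E * w t | t in `]0%R, 1%R[]
  end.

(* For s > 0, B^{-s}_{q,q} is the dual of B^s_{q',q'} for the L^2([0,1]^d)
   pairing, 1/q + 1/q' = 1. *)
Definition besov_neg_norm s q f : \bar R :=
  ereal_sup [set `| \int[lebesgue_cube R d]_y (f y * g y)%:E | | g in
    [set g | measurable_fun setT g /\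
             besov_pos_norm s (hoelder_conjugate q) g <= 1]].

(* Only meant for s != 0. *)
Definition besov_norm s q f : \bar R :=
  if (0 < s)%R then besov_pos_norm s q f else besov_neg_norm (- s) q f.

(* The elements of B^p_{oo,oo} are continuous functions on the cube; each of
   them is represented here by all its Borel extensions to R^d. *)
Definition holder_ball (p L : R) : set ('rV[R]_d -> R) :=
  [set h : 'rV[R]_d -> R |
    [/\ measurable_fun setT h, {within @cube R d, continuous h} &
        besov_norm p +oo h <= L%:E]].

Definition sup_dist f g : \bar R :=
  ereal_sup [set (`|f y - g y|%R)%:E | y in @cube R d].

End besov.

Section npir.
Context (R : realType) (k d : nat).

Local Open Scope ereal_scope.

Definition law_support n (mu : probability 'rV[R]_n R) : set 'rV[R]_n :=
  [set y | forall U : set 'rV[R]_n, open U -> U y -> 0 < mu U].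

(* T h is a version of x |-> E[h(Y2) | X = x], for every h in L^2(Y2). *)
Definition is_cond_expectation d0 (Omega : measurableType d0)
    (Pr : probability Omega R) (X : {RV Pr >-> 'rV[R]_k})
    (Y2 : {RV Pr >-> 'rV[R]_d}) (T : ('rV[R]_d -> R) -> ('rV[R]_k -> R)) :=
  forall h, h \in Lfun (distribution Pr Y2) 2%:E ->
    T h \in Lfun (distribution Pr X) 2%:E /\
    forall A, measurable A ->
      \int[Pr]_(w in X @^-1` A) (T h (X w))%:E =
      \int[Pr]_(w in X @^-1` A) (h (Y2 w))%:E.

(* Q is the law of a pair (Y1, X) such that X has law PX and, conditionally on
   X = x, the error u = Y1 - m X is N(0, sigma2 x). The second parameter of
   normal_prob is the standard deviation. *)
Definition is_npir_law (PX : probability 'rV[R]_k R) (m sigma2 : 'rV[R]_k -> R)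
    (Q : probability (R * 'rV[R]_k)%type R) :=
  forall (B : set R) (A : set 'rV[R]_k), measurable B -> measurable A ->
    Q [set z | B (z.1 - m z.2)%R /\ A z.2] =
    \int[PX]_(x in A) normal_prob 0%R (Num.sqrt (sigma2 x)) B.

(* Functions of a sample of size n whose sup-norm loss is a random variable
   whatever the unknown h in B(p,L). *)
Definition estimator n (p L : R) :
    set (n.-tuple (R * 'rV[R]_k)%type -> 'rV[R]_d -> R) :=
  fun hhat => forall h, holder_ball p L h ->
    measurable_fun [set: n.-tuple (R * 'rV[R]_k)%type]
      (fun z => sup_dist h (hhat z)).

End npir.

(* Main.v *)
(* Lower bound by many hypotheses.  Cut the cube into N^d cells of side
   (r+1) e, r = floor(s) + 1, and let h_m be supported by the m-th cell and equal
   to the adjoint of the r-th difference of step e (1, .., 1) applied to a bump of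
   side e and height A ~ e^p; then h_m lies in the Hoelder ball and the h_m are
   A-separated in sup norm.  Moving the difference to the test function g,
   |int h_m g| = |int bump (r-th difference of g)| <= A e^(d/2) w_r(g, e)_2, and
   w_r(g, e)_2 <= C e^s on the unit ball of B^s_{2,2}; so |T h_m|^2 <= C e^(2(p+s)+d).
   Against the null hypothesis h = 0, the chi-square divergence of the sample
   under h_m is at most K = exp(C n e^(2(p+s)+d)), in the sense that
   (E_m f)^2 <= K E_0 f^2 for every f >= 0, an inequality that is stable under
   products.  Hence P_m(A_m) <= 1/4 + K P_0(A_m), and for the disjoint events
   A_m that the estimator is close to h_m the average of P_m(A_m) is at most
   1/4 + K / N^d <= 1/2 when e^(2(p+s)+d) ~ log n / n. *)
Require Import Defs.
From HB Require Import structures.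
From mathcomp Require Import all_boot all_order all_algebra.
From mathcomp Require Import all_classical all_reals all_analysis.
From mathcomp Require Import measurable_realfun ess_sup_inf.
From mathcomp Require Import ring lra.
Import Order.TTheory GRing.Theory Num.Theory.
Import numFieldNormedType.Exports.
Local Open Scope classical_set_scope.
Local Open Scope ring_scope.

(** * Chi-square bounds and multiple testing *)

(** The obstacle is that only the [L^2] size of [T h] is controlled, whereas the Gaussian divergence
    is an integral of [exp ((T h)^2 / sigma2)], which no [L^2] bound controls by itself. Conditional
    expectation also contracts the sup norm: if [|h| <= sigma0 / 2], the exponent is at most 1/4
    almost everywhere and the exponential is dominated by an affine function of [(T h)^2]. Hence the
    amplitude of the bumps is capped by [sigma0] as well as by [L].

    The difference operator plays the part of the vanishing moments of a wavelet. Its order is the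
    one in the modulus that defines [B^s_{2,2}], so the dual norm is read off that modulus directly.
    The smoothness [p] enters separately, through the exponent of the truncated powers that make up
    the bump.

    The divergence is an inequality between integrals, so no likelihood ratio on the sample space is
    formed. The number of hypotheses is a power of [n]; this is what lets the divergence of the
    whole sample be a small power of [n], and it is the source of the logarithm in the rate. *)

Section chi2.
Local Open Scope ereal_scope.

(* The chi-square divergence of P from Q is at most K - 1. *)
Definition chi2_bound {d} {T : measurableType d} {R : realType} (K : R)
    (P Q : {measure set T -> \bar R}) :=
  forall f : T -> \bar R, measurable_fun setT f -> (forall x, 0 <= f x) ->
  (\int[P]_x f x) * (\int[P]_x f x) <= K%:E * \int[Q]_x (f x * f x).

(** By Tonelli the first bound applies to the inner integral [F], and the second one bounds
    [F x * F x] for each [x] under the outer integral. *)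
Lemma chi2_bound_prod {d1 d2} {T1 : measurableType d1} {T2 : measurableType d2}
    {R : realType} (K1 K2 : R) (P1 Q1 : probability T1 R)
    (P2 Q2 : probability T2 R) : (0 <= K1)%R -> (0 <= K2)%R ->
  chi2_bound K1 P1 Q1 -> chi2_bound K2 P2 Q2 ->
  chi2_bound (K1 * K2)%R (P1 \x P2) (Q1 \x Q2).
Proof.
move=> K10 K20 H1 H2 f mf f0.
have mff : measurable_fun setT (fun z => f z * f z) by exact: emeasurable_funM.
have ff0 z : 0 <= f z * f z by exact: mule_ge0.
rewrite !fubini_tonelli1//.
pose F x := \int[P2]_y f (x, y).
have mF : measurable_fun setT F by exact: measurable_fun_fubini_tonelli_F.
have F0 x : 0 <= F x by exact: integral_ge0.
apply: (le_trans (H1 F mF F0)).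
rewrite EFinM -muleA lee_wpmul2l ?lee_fin//.
rewrite -ge0_integralZl//=; last 2 first.
- exact: measurable_fun_fubini_tonelli_F.
- by move=> x _; exact: integral_ge0.
apply: ge0_le_integral => //.
- by move=> x _; exact: mule_ge0.
- exact: emeasurable_funM.
- by apply: measurable_funeM; exact: measurable_fun_fubini_tonelli_F.
- move=> x _; apply: H2 => //.
  exact: measurableT_comp.
Qed.

Lemma chi2_bound_distribution {d1 d2} {T1 : measurableType d1}
    {T2 : measurableType d2} {R : realType} (K : R) (P Q : probability T1 R)
    (X : {mfun T1 >-> T2}) :
  chi2_bound K P Q -> chi2_bound K (distribution P X) (distribution Q X).
Proof.
move=> H f mf f0; rewrite !ge0_integral_distribution//.
- by apply: H => [|x]/=; [exact: measurableT_comp|exact: f0].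
- exact: emeasurable_funM.
- by move=> y; exact: mule_ge0.
Qed.

Lemma chi2_bound_iid {d} {T : measurableType d} {R : realType} (K : R)
    (P Q : probability T R) n : (0 <= K)%R ->
  chi2_bound K P Q -> chi2_bound (K ^+ n)%R (iid P n) (iid Q n).
Proof.
move=> K0 H; elim: n => [|n IH] /=.
  move=> f mf f0; rewrite !integral_dirac//; last exact: emeasurable_funM.
  by rewrite !diracT !mul1e ?expr0 ?mul1e.
apply: chi2_bound_distribution; rewrite exprS.
by apply: chi2_bound_prod => //; rewrite exprn_ge0.
Qed.

Lemma chi2_bound_measure {d} {T : measurableType d} {R : realType} (K : R)
    (P Q : probability T R) (A : set T) : chi2_bound K P Q -> measurable A ->
  (fine (P A) ^+ 2 <= K * fine (Q A))%R.
Proof.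
move=> H mA.
have mI : measurable_fun setT (fun x => (\1_A x)%:E : \bar R).
  exact/measurable_EFinP/measurable_indic.
have := H _ mI (fun x => ltac:(by rewrite lee_fin)).
have -> : (fun x => (\1_A x)%:E * (\1_A x)%:E) = (fun x => (\1_A x)%:E : \bar R).
  by apply/funext => x; rewrite -EFinM indicE; case: (x \in A); rewrite ?mulr1 ?mulr0.
rewrite !integral_indic// !setIT -lee_fin !EFinM !fineK ?fin_num_measure//.
Qed.

End chi2.

(** If every [P i (A i)] exceeded 1/2, summing [p <= 1/4 + p^2 <= 1/4 + K q] over [i], with the [q]
    summing to at most 1 by disjointness, would give [#|I| / 2 < #|I| / 4 + K], against
    [4 K <= #|I|]. *)
Lemma exists_error_ge {d} {T : measurableType d} {R : realType} (I : finType)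
    (K : R) (P : I -> probability T R) (Q : probability T R) (A : I -> set T) :
  (0 < #|I|)%N -> (forall i, measurable (A i)) -> trivIset setT A ->
  (forall i, chi2_bound K (P i) Q) -> 4 * K <= #|I|%:R ->
  exists i, (2^-1%:E <= P i (~` A i))%E.
Proof.
move=> I0 mA tA H KI.
have pE i : (P i (~` A i) = (1 - fine (P i (A i)))%:E)%E.
  by rewrite probability_setC// EFinB fineK// fin_num_measure.
suff [i Hi] : exists i, fine (P i (A i)) <= 2^-1.
  by exists i; rewrite pE lee_fin; lra.
apply/not_existsP => Hn.
have {}Hn i : 2^-1 < fine (P i (A i)) by rewrite ltNge; apply/negP/Hn.
have K0 : 0 <= K.
  have /card_gt0P[i _] := I0.
  have := chi2_bound_measure _ _ _ setT (H i) measurableT.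
  by rewrite !probability_setT/= expr1n mulr1; apply: le_trans.
have sumQ : \sum_(i : I) fine (Q (A i)) <= 1.
  rewrite -lee_fin -sumEFin.
  under eq_bigr do rewrite fineK ?fin_num_measure//.
  rewrite fsbig_seq ?index_enum_uniq// -measure_fin_bigcup//=; last first.
  - exact: sub_trivIset tA.
  - apply: probability_le1; apply: fin_bigcup_measurable => // i _; exact: mA.
have : \sum_(i : I) (2^-1 : R) < \sum_(i : I) (4^-1 + K * fine (Q (A i))).
  have /card_gt0P[i0 _] := I0.
  apply: ltr_sum; first by apply/hasP; exists i0; rewrite ?mem_index_enum.
  move=> i _; apply: (lt_le_trans (Hn i)).
  have := chi2_bound_measure _ _ _ _ (H i) (mA i).
  (* AM-GM: [p <= 1/4 + p^2] *)
  set p := fine _; have : 0 <= (p - 2^-1) ^+ 2 by exact: sqr_ge0.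
  by move: (fine _) => q; rewrite sqrrB; lra.
have sum_cst (x : R) : \sum_(i : I) x = #|I|%:R * x.
  by rewrite sumr_const mulr_natl.
rewrite big_split/= -mulr_sumr !sum_cst.
suff : K * (\sum_(i : I) fine (Q (A i))) <= K by lra.
by rewrite ler_piMr.
Qed.
(** * Gaussian regression with random design *)

Section density.
Local Open Scope ereal_scope.
Context {d} {T : measurableType d} {R : realType}.
Variables (m : {measure set T -> \bar R}) (w : T -> R).
Hypotheses (mw : measurable_fun setT w) (w0 : forall x, (0 <= w x)%R).

(* The hypotheses are arguments only so that the measure structure below can be
   inferred. *)
Definition mdensity (_ : measurable_fun setT w) (_ : forall x, (0 <= w x)%R)
  (A : set T) : \bar R := \int[m]_(x in A) (w x)%:E.

Local Notation D := (mdensity mw w0).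

Let D0 : D set0 = 0. Proof. exact: integral_set0. Qed.

Let mwE : measurable_fun setT (EFin \o w).
Proof. exact/measurable_EFinP. Qed.

Let D_ge0 A : 0 <= D A.
Proof. by apply: integral_ge0 => x _; rewrite lee_fin. Qed.

Let D_additive : semi_sigma_additive D.
Proof.
move=> /= A mA tA mUA; rewrite /mdensity/= ge0_integral_bigcup//=.
- apply: is_cvg_ereal_nneg_natsum_cond => n _ _.
  by apply: integral_ge0 => x _; rewrite lee_fin.
- exact: measurable_funTS.
- by move=> x _; rewrite lee_fin.
Qed.

HB.instance Definition _ := isMeasure.Build _ _ _ D D0 D_ge0 D_additive.

Import HBNNSimple.

(** Indicators first, then simple functions by linearity, then monotone convergence along
    [nnsfun_approx]. *)
Lemma ge0_integral_mdensity (f : T -> \bar R) : measurable_fun setT f ->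
  (forall x, 0 <= f x) ->
  \int[D]_x f x = \int[m]_x (f x * (w x)%:E).
Proof.
move=> mf f0.
have indicE A : measurable A ->
    \int[D]_x (\1_A x)%:E = \int[m]_x ((\1_A x)%:E * (w x)%:E).
  move=> mA; rewrite integral_indic//= setIT /mdensity integral_mkcond.
  apply: eq_integral => x _; rewrite patchE indicE.
  by case: ifPn => _; rewrite ?mul1e ?mul0e.
have nnsfunE (g : {nnsfun T >-> R}) :
    \int[D]_x (g x)%:E = \int[m]_x ((g x)%:E * (w x)%:E).
  under [LHS]eq_integral do rewrite fimfunE -fsumEFin//.
  rewrite [LHS]ge0_integral_fsum//; last 2 first.
    - by move=> r; exact/measurable_EFinP/measurableT_comp.
    - by move=> n x _; rewrite EFinM nnfun_muleindic_ge0.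
  under [RHS]eq_integral.
    move=> x _; rewrite fimfunE -fsumEFin// ge0_mule_fsuml; last first.
      by move=> r; rewrite EFinM nnfun_muleindic_ge0.
    over.
  rewrite [RHS]ge0_integral_fsum//; last 2 first.
    - move=> r; apply: emeasurable_funM => //.
      by apply/measurable_EFinP; do 2 apply/measurableT_comp => //.
    - move=> n x _; apply: mule_ge0; last by rewrite lee_fin.
      by rewrite EFinM nnfun_muleindic_ge0.
  apply: eq_fsbigr => r _.
  rewrite integralZl_indic_nnsfun//= indicE//.
  have [r0|r0] := leP 0%R r.
    rewrite -ge0_integralZl//; first by apply: eq_integral => x _; rewrite EFinM muleA.
    - apply: emeasurable_funM => //.
      exact/measurable_EFinP.
    - by move=> x _; rewrite mule_ge0 ?lee_fin.
  (* A nonnegative function never takes the value [r < 0], so both integrals are those of 0. *)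
  rewrite preimage_nnfun0// [in LHS]integral0_eq ?mule0; last first.
    by move=> x _; rewrite indic0 mul0e.
  by rewrite integral0_eq// => x _; rewrite indic0 mulr0 mul0e.
pose g := nnsfun_approx measurableT mf.
transitivity (lim (\int[D]_x (g n x)%:E @[n --> \oo])).
  rewrite -monotone_convergence//=.
  - apply: eq_integral => ? /[!inE] xD; apply/esym/cvg_lim => //=.
    exact: cvg_nnsfun_approx.
  - by move=> n; exact/measurable_EFinP/measurable_funTS.
  - by move=> n ? _; rewrite lee_fin.
  - by move=> ? _ ? ? mn; rewrite lee_fin; exact/lefP/nd_nnsfun_approx.
under eq_fun do rewrite nnsfunE.
rewrite -monotone_convergence//=.
- apply: eq_integral => x _; apply/cvg_lim => //=.
  by apply: cvgeZr => //; exact: cvg_nnsfun_approx.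
- move=> n; apply: emeasurable_funM => //.
  exact/measurable_EFinP/measurable_funTS.
- by move=> n x _; rewrite mule_ge0 ?lee_fin.
- move=> x _ a b ab; apply: lee_wpmul2r; rewrite lee_fin//.
  exact/lefP/nd_nnsfun_approx.
Qed.

End density.

(** Lebesgue measure is determined by its values on half-open intervals, where the shift preserves
    length. *)
Lemma lebesgue_measure_shift {R : realType} (c : R) (A : set R) :
  measurable A ->
  pushforward lebesgue_measure
    (fun x : measurableTypeR R => x + c : measurableTypeR R) A =
  lebesgue_measure A.
Proof.
move=> mA.
have ms : measurable_fun setT (fun x : measurableTypeR R => x + c : measurableTypeR R).
  exact: measurable_funD.
pose S : {mfun measurableTypeR R >-> measurableTypeR R} :=
  @mfun_Sub _ _ (measurableTypeR R) (measurableTypeR R) _ (mem_set ms).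
apply/esym.
apply: (@lebesgue_measure_unique _ (pushforward lebesgue_measure S)) => //= _ [[a b]] _ <-.
rewrite /pushforward/= (_ : _ @^-1` _ = `]a - c, b - c]%classic); last first.
  by apply/seteqP; split => x /=; rewrite !in_itv/= ltrBlDr lerBrDr.
rewrite !lebesgue_measure_itv/= !lte_fin ltrD2r; case: ifP => // _.
by rewrite -!EFinD; congr EFin; ring.
Qed.

Lemma ge0_integral_shift {R : realType} (c : R) (f : R -> \bar R) :
  measurable_fun setT f -> (forall x, 0 <= f x)%E ->
  (\int[lebesgue_measure]_x f (x + c)%R = \int[lebesgue_measure]_x f x)%E.
Proof.
move=> mf f0.
have ms : measurable_fun setT (fun x : measurableTypeR R => x + c : measurableTypeR R).
  exact: measurable_funD.
pose S : {mfun measurableTypeR R >-> measurableTypeR R} :=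
  @mfun_Sub _ _ (measurableTypeR R) (measurableTypeR R) _ (mem_set ms).
transitivity (\int[pushforward lebesgue_measure S]_x f x)%E.
  by rewrite ge0_integral_pushforward.
apply: eq_measure_integral => A mA _; exact: lebesgue_measure_shift.
Qed.

Lemma measurable_normal_pdf_comp {d} {T : measurableType d} {R : realType}
    (m v y : T -> R) : measurable_fun setT m -> measurable_fun setT v ->
  measurable_fun setT y -> (forall t, 0 < v t) ->
  measurable_fun setT (fun t => normal_pdf (m t) (Num.sqrt (v t)) (y t)).
Proof.
move=> mm mv my v0.
(* Inverses become powers of exponent -1, so that the measurability of [powR] applies. *)
rewrite (_ : (fun t => _) = fun t => (Num.sqrt (v t * pi * 2)) `^ (-1) *
    expR (- (y t - m t) ^+ 2 * (v t * 2) `^ (-1))); last first.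
  apply/funext => t.
  have sv0 : Num.sqrt (v t) != 0 by rewrite gt_eqF// sqrtr_gt0.
  rewrite normal_pdfE// /normal_peak /normal_fun sqr_sqrtr; last exact: ltW.
  by rewrite !powR_inv1 ?sqrtr_ge0 ?mulr_natr// mulrn_wge0// ltW.
apply: measurable_funM.
  apply: (measurableT_comp (measurable_powR _)).
  apply: (measurableT_comp (continuous_measurable_fun (@sqrt_continuous _))).
  by do 2 apply: measurable_funM => //.
apply: (measurableT_comp (@measurable_expR _)); apply: measurable_funM.
  apply: measurableT_comp => //; apply: measurable_funX.
  exact: measurable_funB.
by apply: (measurableT_comp (measurable_powR _)); exact: measurable_funM.
Qed.

(** Completing the square. Divided by the density of mean [m0], it says that the squared density is
    a constant times the density of mean [2 m - m0]; that constant is the Gaussian chi-square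
    term. *)
Lemma normal_pdf_sqr {R : realType} (m m0 s y : R) : s != 0 ->
  normal_pdf m s y ^+ 2 = expR ((m - m0) ^+ 2 / s ^+ 2) *
    normal_pdf (m *+ 2 - m0) s y * normal_pdf m0 s y.
Proof.
move=> s0; rewrite !normal_pdfE// /normal_fun.
set k := normal_peak s; set E1 := expR _; set E2 := expR _; set E3 := expR _.
set E4 := expR _.
suff E : E1 ^+ 2 = E2 * E3 * E4 by rewrite exprMn E; ring.
by rewrite /E1 /E2 /E3 /E4 -expRM_natl -!expRD; congr expR; field.
Qed.

(** * Regression laws as Gaussian mixtures *)

Section npir_law.
Context {R : realType} {k : nat}.
Variables (PX : probability 'rV[R]_k R) (v : 'rV[R]_k -> R).
Hypotheses (mv : measurable_fun setT v) (v0 : forall x, 0 < v x).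

Local Notation RT := (measurableTypeR R).
Local Notation leb := (@lebesgue_measure R).

(** [is_npir_law] prescribes [Q] on sets of errors and regressors. The shear [s] passes to these
    coordinates, where [Q] becomes the measure of density [w], and [u] is its inverse. *)
Lemma integral_npir_law (m : 'rV[R]_k -> R)
    (Q : probability (R * 'rV[R]_k)%type R) (f : R * 'rV[R]_k -> \bar R) :
  measurable_fun setT m -> is_npir_law PX m v Q ->
  measurable_fun setT f -> (forall z, 0 <= f z)%E ->
  (\int[Q]_z f z = \int[PX]_x \int[leb]_y
    (f (y, x) * (normal_pdf (m x) (Num.sqrt (v x)) y)%:E))%E.
Proof.
move=> mm HQ mf f0.
pose s (z : R * 'rV[R]_k) : RT * 'rV[R]_k := (z.1 - m z.2, z.2).
pose u (z : RT * 'rV[R]_k) : R * 'rV[R]_k := (z.1 + m z.2, z.2).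
have ms : measurable_fun setT s.
  apply/measurable_fun_pairP; split; last exact: measurable_snd.
  by apply: measurable_funB => //; exact: measurableT_comp.
have mu : measurable_fun setT u.
  apply/measurable_fun_pairP; split; last exact: measurable_snd.
  by apply: measurable_funD; [exact: measurable_fst|exact: measurableT_comp].
have us z : u (s z) = z by case: z => y x; rewrite /u/s/= subrK.
pose S : {mfun (R * 'rV[R]_k)%type >-> (RT * 'rV[R]_k)%type} :=
  @mfun_Sub _ _ (R * 'rV[R]_k)%type (RT * 'rV[R]_k)%type _ (mem_set ms).
pose w (z : RT * 'rV[R]_k) := normal_pdf 0 (Num.sqrt (v z.2)) z.1.
have mw : measurable_fun setT w.
  apply: measurable_normal_pdf_comp => [|||t]; last exact: v0.
  - exact: measurable_cst.
  - exact: measurableT_comp.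
  - exact: measurable_fst.
have w0 z : 0 <= w z by exact: normal_pdf_ge0.
pose D := mdensity (leb \x PX)%E w mw w0.
(* On rectangles this is the definition of [is_npir_law], once the integral of [w] is iterated. *)
have DE A B : measurable A -> measurable B ->
    pushforward Q S (A `*` B) = D (A `*` B).
  move=> mA mB.
  rewrite /pushforward [LHS](_ : _ = Q [set z | A (z.1 - m z.2) /\ B z.2])//.
  rewrite HQ// /D/= /mdensity integral_mkcond fubini_tonelli2//; last 2 first.
  - by apply/(measurable_restrictT _ _).1 => //;
      [exact: measurableX|exact/measurable_funTS/measurable_EFinP].
  - by move=> z; apply: erestrict_ge0 => ? _; rewrite lee_fin.
  rewrite [LHS]integral_mkcond; apply: eq_integral => x _.
  rewrite /fubini_G patchE; case: ifPn => xB.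
    rewrite /normal_prob [LHS]integral_mkcond. apply: eq_integral => y _.
    rewrite !patchE; congr (if _ then _ else _).
    by rewrite in_setX/= xB andbT.
  rewrite integral0_eq// => y _; rewrite patchE ifF//.
  by apply/negbTE; apply: contra xB; rewrite !inE => -[].
(* Rectangles are stable under intersection and generate the product sigma-algebra. *)
have QD A : measurable A -> pushforward Q S A = D A.
  pose C := [set A `*` B | A in @measurable _ RT & B in @measurable _ 'rV[R]_k].
  apply: (measure_unique C (fun=> setT)).
  - by rewrite measurable_prod_measurableType.
  - move=> _ _ [A1 mA1 [A2 mA2 <-]] [B1 mB1 [B2 mB2 <-]].
    rewrite -setXI; exists (A1 `&` B1); first exact: measurableI.
    by exists (A2 `&` B2); first exact: measurableI.
  - by move=> _; exists setT => //; exists setT => //; rewrite setXTT.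
  - by rewrite bigcup_const.
  - by move=> _ [A1 mA1 [A2 mA2 <-]]; exact: DE.
  - move=> _; suff: (Q setT < +oo)%E by [].
    by rewrite probability_setT ltry.
transitivity (\int[D]_z f (u z))%E.
  transitivity (\int[pushforward Q S]_z f (u z))%E.
    rewrite ge0_integral_pushforward//; last exact: measurableT_comp.
    by apply: eq_integral => z _ /=; rewrite us.
  by apply: eq_measure_integral => A mA _; exact: QD.
rewrite ge0_integral_mdensity//; last exact: measurableT_comp.
pose F z := (f (u z) * (w z)%:E)%E.
have mF : measurable_fun setT F.
  by apply: emeasurable_funM; [exact: measurableT_comp|exact/measurable_EFinP].
have F0 z : (0 <= F z)%E by rewrite mule_ge0// lee_fin.
rewrite (fubini_tonelli2 F mF F0).
apply: eq_integral => x _; rewrite /fubini_G.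
(* For fixed [x], translating the error by [- m x] restores the observation and recentres the
   density at [m x]. *)
rewrite -(ge0_integral_shift (m x)); first last.
- by move=> y; rewrite mule_ge0// lee_fin normal_pdf_ge0.
- apply: emeasurable_funM.
    by apply: (measurableT_comp mf); exact: pair2_measurable.
  by apply/measurable_EFinP; exact: measurable_normal_pdf.
apply: eq_integral => y _; rewrite /F/u/w/=; congr (_ * _%:E)%E.
rewrite !normal_pdfE ?gt_eqF ?sqrtr_gt0//.
by rewrite /normal_fun subr0 addrK.
Qed.

End npir_law.
(** The hypothesis at [t = K / a] is the conclusion. Unlike the quadratic inequality, the family
    over [t] is linear in [a] and [b], hence can be integrated over the design. *)
Lemma mule_sqr_le_of_amgm {R : realType} (K : R) (a b : \bar R) : 0 < K ->
  (0 <= a)%E -> (0 <= b)%E ->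
  (forall t : R, (0 < t)%R -> a + a <= (K / t)%:E + t%:E * b)%E ->
  (a * a <= K%:E * b)%E.
Proof.
move=> K0; case: b => [b| |]// + b0 H; last first.
  by rewrite gt0_muley ?leey ?lte_fin.
case: a H => [a| |]// H a0; last first.
  by have := H 1 ltr01; rewrite -EFinM -EFinD leye_eq.
rewrite !lee_fin in a0 b0 *; move: a0; rewrite le_eqVlt => /predU1P[<-|a0].
  by rewrite mul0r mulr_ge0// ltW.
have := H (K / a); rewrite divr_gt0// => /(_ isT); rewrite -!EFinD lee_fin.
have -> : K / (K / a) = a by field; rewrite !gt_eqF.
rewrite lerD2l mulrAC ler_pdivlMr//.
Qed.

(** Pointwise AM-GM, [2 f p <= p^2 / (t a) + t f^2 a] for the densities [p] and [a] of means [m] and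
    [m0], where [normal_pdf_sqr] makes the integral of [p^2 / a] explicit. *)
Lemma normal_pdf_amgm {R : realType} (m m0 s t : R) (f : R -> \bar R) :
  s != 0 -> 0 < t -> measurable_fun setT f -> (forall y, 0 <= f y)%E ->
  (\int[lebesgue_measure]_y (f y * (normal_pdf m s y)%:E) +
   \int[lebesgue_measure]_y (f y * (normal_pdf m s y)%:E) <=
   (expR ((m - m0) ^+ 2 / s ^+ 2) / t)%:E +
   t%:E * \int[lebesgue_measure]_y (f y * f y * (normal_pdf m0 s y)%:E))%E.
Proof.
move=> s0 t0 mf f0.
set e := expR _.
have e0 : 0 < e by exact: expR_gt0.
have mp a : measurable_fun setT (EFin \o normal_pdf a s).
  by apply/measurable_EFinP; exact: measurable_normal_pdf.
have p0 a y : (0 <= (normal_pdf a s y)%:E)%E by rewrite lee_fin normal_pdf_ge0.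
have mfp a : measurable_fun setT (fun y => f y * (normal_pdf a s y)%:E)%E.
  by apply: emeasurable_funM => //; exact: mp.
have mffp a : measurable_fun setT (fun y => f y * f y * (normal_pdf a s y)%:E)%E.
  by apply: emeasurable_funM; [exact: emeasurable_funM|exact: mp].
(* The density of mean [2 m - m0] has mass 1, so the constant can join the other terms under the
   integral. *)
have -> : (e / t)%:E = (\int[lebesgue_measure]_y
    ((e / t)%:E * (normal_pdf (m *+ 2 - m0) s y)%:E))%E.
  rewrite ge0_integralZl ?integral_normal_pdf ?mule1//; first exact: mp.
  by rewrite lee_fin divr_ge0// ltW.
rewrite -ge0_integralZl//; last 3 first.
- exact: mffp.
- by move=> y _; rewrite !mule_ge0.
- by rewrite lee_fin ltW.
have et0 : 0 <= e / t by rewrite divr_ge0 ?ltW.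
have fp0 a y : (0 <= f y * (normal_pdf a s y)%:E)%E by exact: mule_ge0.
have etp0 y : (0 <= (e / t)%:E * (normal_pdf (m *+ 2 - m0) s y)%:E)%E.
  exact: mule_ge0.
have ffp0 y : (0 <= t%:E * (f y * f y * (normal_pdf m0 s y)%:E))%E.
  by rewrite !mule_ge0// lee_fin ltW.
rewrite -!ge0_integralD//; try first
  [exact: mfp|apply: measurable_funeM; exact: mp|apply: measurable_funeM; exact: mffp].
apply: ge0_le_integral => //.
- by move=> y _; rewrite adde_ge0.
- by apply: emeasurable_funD; exact: mfp.
- by apply: emeasurable_funD; apply: measurable_funeM; [exact: mp|exact: mffp].
move=> y _; have := f0 y; case: (f y) => [r| |]// r0; last first.
  rewrite [leRHS](_ : _ = +oo%E) ?leey//.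
  rewrite mulyy gt0_mulye ?lte_fin; last first.
    by rewrite normal_pdfE// mulr_gt0 ?expR_gt0 ?normal_peak_gt0.
  by rewrite gt0_muley ?lte_fin// addey// -EFinM.
rewrite -!EFinM -!EFinD lee_fin; rewrite lee_fin in r0.
have := normal_pdf_sqr m m0 s y s0; rewrite -/e.
have : 0 < normal_pdf m0 s y.
  by rewrite normal_pdfE// mulr_gt0 ?expR_gt0 ?normal_peak_gt0.
move: (normal_pdf m s y) (normal_pdf m0 s y) (normal_pdf (m *+ 2 - m0) s y).
move=> p a q a0 pE.
(* After multiplication by [t * a], the difference of the two sides is [(p - t r a)^2]. *)
rewrite -(ler_pM2r (mulr_gt0 t0 a0)).
have -> : (e / t * q + t * (r * r * a)) * (t * a) = e * q * a + (t * r * a) ^+ 2.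
  by field; rewrite gt_eqF.
rewrite -pE; have := sqr_ge0 (p - t * r * a); rewrite sqrrB.
have -> : (r * p + r * p) * (t * a) = p * (t * r * a) *+ 2 by ring.
lra.
Qed.

(** [normal_pdf_amgm] is used with the same [t] at every [x] and integrated in [x]; only then is [t]
    optimised, by [mule_sqr_le_of_amgm]. *)
Lemma chi2_bound_npir_law {R : realType} {k : nat} (PX : probability 'rV[R]_k R)
    (v m m0 : 'rV[R]_k -> R) (Q Q0 : probability (R * 'rV[R]_k)%type R) (K : R) :
  measurable_fun setT v -> (forall x, 0 < v x) ->
  measurable_fun setT m -> measurable_fun setT m0 ->
  is_npir_law PX m v Q -> is_npir_law PX m0 v Q0 ->
  (\int[PX]_x (expR ((m x - m0 x) ^+ 2 / v x))%:E <= K%:E)%E ->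
  chi2_bound K Q Q0.
Proof.
move=> mv v0 mm mm0 HQ HQ0 HK f mf f0.
have mff : measurable_fun setT (fun z => f z * f z)%E by exact: emeasurable_funM.
have ff0 z : (0 <= f z * f z)%E by exact: mule_ge0.
pose E x := expR ((m x - m0 x) ^+ 2 / v x).
have mE : measurable_fun setT E.
  rewrite (_ : E = fun x => expR ((m x - m0 x) ^+ 2 * (v x) `^ (-1))).
    apply: (measurableT_comp (@measurable_expR _)); apply: measurable_funM.
      by apply: measurable_funX; exact: measurable_funB.
    exact: (measurableT_comp (measurable_powR _)).
  by apply/funext => x; rewrite powR_inv1// ltW.
(* The integrand bounded by [K] is at least 1. *)
have K0 : 0 < K.
  apply: (@lt_le_trans _ _ 1) => //; rewrite -lee_fin; apply: le_trans HK.
  have -> : 1%E = (\int[PX]_x (1 : \bar R))%E.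
    rewrite integral_cst//. rewrite mul1e; exact: esym (probability_setT PX).
  apply: ge0_le_integral => //; first exact/measurable_EFinP.
    by move=> x _; rewrite lee_fin -expR0 ler_expR mulr_ge0 ?sqr_ge0// invr_ge0 ltW.
apply: mule_sqr_le_of_amgm => //; [exact: integral_ge0|exact: integral_ge0|].
move=> t t0.
rewrite (integral_npir_law PX v mv v0 m Q f mm HQ mf f0).
rewrite (integral_npir_law PX v mv v0 m0 Q0 _ mm0 HQ0 mff ff0).
have mG (g : R * 'rV[R]_k -> \bar R) (a : 'rV[R]_k -> R) :
    measurable_fun setT a -> measurable_fun setT g -> (forall z, 0 <= g z)%E ->
    measurable_fun setT (fun x => \int[lebesgue_measure]_y
      (g (y, x) * (normal_pdf (a x) (Num.sqrt (v x)) y)%:E))%E.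
  move=> ma mg g0.
  apply: (measurable_fun_fubini_tonelli_G (m1 := lebesgue_measure)
   (fun z : measurableTypeR R * 'rV[R]_k =>
     g z * (normal_pdf (a z.2) (Num.sqrt (v z.2)) z.1)%:E)%E).
    apply: emeasurable_funM => //; apply/measurable_EFinP.
    apply: measurable_normal_pdf_comp => //.
    - exact: measurableT_comp.
    - exact: measurableT_comp.
  by move=> z; rewrite mule_ge0// lee_fin normal_pdf_ge0.
have G0 (g : R * 'rV[R]_k -> \bar R) (a : 'rV[R]_k -> R) x :
    (forall z, 0 <= g z)%E -> (0 <= \int[lebesgue_measure]_y
      (g (y, x) * (normal_pdf (a x) (Num.sqrt (v x)) y)%:E))%E.
  by move=> g0; apply: integral_ge0 => y _; rewrite mule_ge0// lee_fin normal_pdf_ge0.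
have Et0 x : 0 <= E x / t by rewrite divr_ge0 ?expR_ge0 ?ltW.
apply: (@le_trans _ _ ((\int[PX]_x (E x / t)%:E) + t%:E * \int[PX]_x
   \int[lebesgue_measure]_y
      (f (y, x) * f (y, x) * (normal_pdf (m0 x) (Num.sqrt (v x)) y)%:E)))%E; last first.
  apply: leeD2r; under eq_integral do rewrite mulrC EFinM.
  rewrite ge0_integralZl//; last 3 first.
  - exact/measurable_EFinP.
  - by move=> x _; rewrite lee_fin expR_ge0.
  - by rewrite lee_fin invr_ge0 ltW.
  by rewrite mulrC EFinM lee_wpmul2l// lee_fin invr_ge0 ltW.
rewrite -ge0_integralZl//; last 3 first.
- exact: (mG _ _ mm0 mff).
- by move=> x _; exact: (G0 (fun z => f z * f z)%E).
- by rewrite lee_fin ltW.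
rewrite -!ge0_integralD//; try first
  [by move=> x _; rewrite lee_fin
  |by apply/measurable_EFinP; apply: measurable_funM
  |by move=> x _; rewrite mule_ge0 ?lee_fin ?(ltW t0)//; exact: (G0 (fun z => f z * f z)%E)
  |by apply: measurable_funeM; exact: (mG _ _ mm0 mff)
  |by move=> x _; exact: G0
  |exact: mG].
apply: ge0_le_integral => //.
- by move=> x _; rewrite adde_ge0//; exact: G0.
- by apply: emeasurable_funD; exact: mG.
- apply: emeasurable_funD.
    by apply/measurable_EFinP; apply: measurable_funM.
  by apply: measurable_funeM; exact: (mG _ _ mm0 mff).
move=> x _.
have sv0 : Num.sqrt (v x) != 0 by rewrite gt_eqF// sqrtr_gt0.
have := @normal_pdf_amgm R (m x) (m0 x) _ t (fun y => f (y, x)) sv0 t0.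
rewrite (sqr_sqrtr (ltW (v0 x))); apply => //.
by apply: (measurableT_comp mf); exact: pair2_measurable.
Qed.

(** * Conditional expectations of bounded functions *)

(** On [D], where [F > A], the integral of [F] equals that of [G], hence is at most [A * P D]. The
    positive function [F - A] then has integral 0 on [D], so [D] is null. *)
Lemma excess_set_null {d} {T : measurableType d} {R : realType}
    (P : probability T R) (F G : T -> R) (A : R) : 0 <= A ->
  measurable_fun setT F -> measurable_fun setT G -> (forall w, `|G w| <= A) ->
  (\int[P]_(w in [set w | (A < F w)%R]) (F w)%:E =
   \int[P]_(w in [set w | (A < F w)%R]) (G w)%:E)%E ->
  P [set w | A < F w] = 0%E.
Proof.
move=> A0 mF mG GA; set D := [set w | _] => FG.
have mD : measurable D.
  by rewrite -[D]setTI; exact: measurable_fun_ltr.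
have mFA : measurable_fun D (fun w => (F w - A)%:E).
  by apply/measurable_EFinP; apply: measurable_funTS; exact: measurable_funB.
have FA0 w : D w -> (0 <= (F w - A)%:E)%E.
  by move=> /ltW DFw; rewrite lee_fin subr_ge0.
have intA : (\int[P]_(w in D) A%:E = A%:E * P D)%E by rewrite integral_cst.
have le1 : (\int[P]_(w in D) (F w)%:E <= A%:E * P D)%E.
  rewrite FG (le_trans (lee_abs _))// (le_trans (le_abse_integral _ _ _))//.
    by apply/measurable_EFinP; exact: measurable_funTS.
  apply: integral_le_bound => //.
  - by apply/measurable_EFinP; exact: measurable_funTS.
  - by apply/aeW => w _; rewrite abse_EFin lee_fin.
have le2 : (\int[P]_(w in D) `|(F w - A)%:E| = 0)%E.
  apply/eqP; rewrite eq_le integral_ge0// andbT.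
  rewrite (eq_integral (fun w => (F w - A)%:E)); last first.
    by move=> w /set_mem wD; rewrite gee0_abs ?FA0.
  rewrite -(leeD2lE (x := (A%:E * P D)%E)); last by rewrite fin_numM// fin_num_measure.
  rewrite adde0 -{1}intA -ge0_integralD//.
  by under eq_integral do rewrite -EFinD subrKC.
have /(ae_eq_integral_abs P mD mFA) := le2.
case=> N [mN PN0 DN]; apply/eqP; rewrite eq_le measure_ge0 andbT -PN0.
apply: le_measure; rewrite ?inE//; apply: subset_trans DN => w Dw /= H.
have := H Dw => -[] /eqP; rewrite subr_eq0 => /eqP FwA.
by move: Dw; rewrite /D/= FwA ltxx.
Qed.

(** The sets [T h > A] and [- T h > A] are themselves events of [X], so the defining identity can be
    tested on them. *)
Lemma cond_expectation_bounded {R : realType} {k n : nat} {d0}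
    {Omega : measurableType d0} (Pr : probability Omega R)
    (X : {RV Pr >-> 'rV[R]_k}) (Y : {RV Pr >-> 'rV[R]_n})
    (T : ('rV[R]_n -> R) -> ('rV[R]_k -> R)) (h : 'rV[R]_n -> R) (A : R) :
  is_cond_expectation X Y T -> 0 <= A -> measurable_fun setT h ->
  (forall y, `|h y| <= A) ->
  measurable_fun setT (T h) /\ {ae distribution Pr X, forall x, `|T h x| <= A}.
Proof.
move=> HT A0 mh hA.
have hL : h \in Lfun (distribution Pr Y) 2%:E.
  apply/andP; split; first by rewrite inE.
  rewrite inE/= /finite_norm unlock; apply: poweR_lty.
  apply: (@le_lt_trans _ _ (\int[distribution Pr Y]_x (A `^ 2)%:E)%E); last first.
    by rewrite integral_cst//= probability_setT mule1 ltry.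
  apply: ge0_le_integral => //.
  - by move=> x _; exact: poweR_ge0.
  - suff : measurable_fun setT (EFin \o (fun x => `|h x| `^ 2)) by [].
    apply/measurable_EFinP; apply: (measurableT_comp (measurable_powR _)).
    exact: measurableT_comp.
  - by move=> x _; rewrite /= lee_fin ge0_ler_powR ?nnegrE.
have [TL HTA] := HT _ hL.
have mT : measurable_fun setT (T h).
  by move: TL => /andP[]; rewrite inE.
split => //.
have mTX : measurable_fun setT (T h \o X) by exact: measurableT_comp.
have mhY : measurable_fun setT (h \o Y) by exact: measurableT_comp.
have mB (g : 'rV[R]_k -> R) : measurable_fun setT g -> measurable [set x | A < g x].
  by move=> mg; rewrite -[X in measurable X]setTI; exact: measurable_fun_ltr.
have n1 : Pr (X @^-1` [set x | A < T h x]) = 0%E.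
  apply: (excess_set_null Pr (T h \o X) (h \o Y) A) => //.
  - by move=> w /=.
  - exact: (HTA _ (mB _ mT)).
have n2 : Pr (X @^-1` [set x | A < - T h x]) = 0%E.
  apply: (excess_set_null Pr (fun w => - T h (X w)) (fun w => - h (Y w)) A) => //.
  - exact: measurableT_comp.
  - exact: measurableT_comp.
  - by move=> w; rewrite normrN.
  (* The identity concerns [T h], so for the lower bound both of its sides are negated: the left one
     by sign on [D], the right one because [h \o Y] is bounded and thus integrable. *)
  - have mNT : measurable_fun setT (fun x => - T h x) by exact: measurableT_comp.
    have := HTA _ (mB _ mNT).
    set D := X @^-1` _ => HD /=.
    rewrite -/D.
    have mD : measurable D by exact: (measurable_funPTI X (mB _ mNT)).
    apply: (@oppe_inj R).
    rewrite -integral_ge0N; last first.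
      by move=> w /ltW; rewrite lee_fin; apply: le_trans.
    under eq_integral do rewrite EFinN oppeK.
    rewrite HD.
    under [in RHS]eq_integral do rewrite EFinN.
    rewrite integralN ?oppeK//.
    apply: integrable_add_def; first exact: mD.
    apply: (le_integrable mD (g := cst A%:E)).
    + by apply/measurable_EFinP; exact: measurable_funTS.
    + by move=> w _; rewrite /= lee_fin (ger0_norm A0).
    + exact: finite_measure_integrable_cst.
exists ([set x | A < T h x] `|` [set x | A < - T h x]); split.
- by apply: measurableU; apply: mB => //; exact: measurableT_comp.
- apply/eqP; rewrite -measure_le0; apply: le_trans (measureU2 _ _ _) _ => //.
  + exact: mB.
  + by apply: mB; exact: measurableT_comp.
  by have -> : (distribution Pr X [set x | (A < T h x)%R] +
    distribution Pr X [set x | (A < - T h x)%R] = 0)%E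
    by exact: (etrans (f_equal2 _ n1 n2) (adde0 _)).
- move=> x /= /negP; rewrite -ltNge lter_normr => /orP[]; by [left|right].
Qed.

(** From [1 - u <= exp (- u)] follows [exp u <= 1 / (1 - u)], and
    [(1 + 2 u) (1 - u) = 1 + u (1 - 2 u)] is at least 1. *)
Lemma expR_le_1D2x {R : realType} (u : R) : 0 <= u -> u <= 2^-1 ->
  expR u <= 1 + 2 * u.
Proof.
move=> u0 u2; have u1 : 0 < 1 - u by lra.
have : expR u * (1 - u) <= expR u * expR (- u).
  by rewrite ler_wpM2l ?expR_ge0// expR_ge1Dx.
rewrite expRxMexpNx_1 -ler_pdivlMr// => /le_trans; apply.
rewrite ler_pdivrMr//; have := mulr_ge0 u0 (_ : 0 <= 2^-1 - u).
by rewrite subr_ge0 => /(_ u2); nra.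
Qed.

(** The sup bound [sigma0 / 2] makes the exponent small enough for [expR_le_1D2x]; after that only
    the [L^2] norm of [T h] matters. *)
Lemma chi2_bound_cond_expectation {R : realType} {k n : nat} {d0}
    {Omega : measurableType d0} (Pr : probability Omega R)
    (X : {RV Pr >-> 'rV[R]_k}) (Y : {RV Pr >-> 'rV[R]_n})
    (T : ('rV[R]_n -> R) -> ('rV[R]_k -> R)) (v : 'rV[R]_k -> R)
    (Q Q0 : probability (R * 'rV[R]_k)%type R)
    (h : 'rV[R]_n -> R) (sigma0 A B : R) :
  0 < sigma0 -> is_cond_expectation X Y T ->
  measurable_fun setT v -> (forall x, sigma0 ^+ 2 <= v x) ->
  measurable_fun setT h -> 0 <= A <= sigma0 / 2 -> (forall y, `|h y| <= A) ->
  0 <= B -> ('N[distribution Pr X]_2%:E[EFin \o T h] <= B%:E)%E ->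
  is_npir_law (distribution Pr X) (T h) v Q ->
  is_npir_law (distribution Pr X) (T (cst 0)) v Q0 ->
  chi2_bound (expR (2 / sigma0 ^+ 2 * B ^+ 2)) Q Q0.
Proof.
move=> s0 HT mv vs mh /andP[A0 As] hA B0 HB HQ HQ0.
have v0 x : 0 < v x by rewrite (lt_le_trans _ (vs x))// exprn_gt0.
have [mT TA] := cond_expectation_bounded Pr X Y T h A HT A0 mh hA.
(* [T (cst 0)] is a version of 0, hence 0 almost everywhere: the contraction with [A = 0]. *)
have [mT0 T00] : measurable_fun setT (T (cst 0)) /\
    {ae distribution Pr X, forall x, `|T (cst 0) x| <= 0}.
  by apply: (cond_expectation_bounded Pr X Y T (cst 0)) => // y; rewrite normr0.
apply: (chi2_bound_npir_law _ _ _ _ _ _ _ mv v0 mT mT0 HQ HQ0).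
set c := 2 / sigma0 ^+ 2.
have c0 : 0 <= c by rewrite divr_ge0// sqr_ge0.
have mT2 : measurable_fun setT (fun x => (T h x) ^+ 2) by exact: measurable_funX.
apply: (@le_trans _ _ (\int[distribution Pr X]_x (1 + c * (T h x) ^+ 2)%:E)%E).
  apply: ae_ge0_le_integral => //.
  - apply/measurable_EFinP; apply: (measurableT_comp (@measurable_expR _)).
    rewrite (_ : (fun x => _) = fun x => (T h x - T (cst 0) x) ^+ 2 * (v x) `^ (-1)).
      apply: measurable_funM; first by apply: measurable_funX; exact: measurable_funB.
      exact: (measurableT_comp (measurable_powR _)).
    by apply/funext => x; rewrite powR_inv1// ltW.
  - by move=> x _; rewrite lee_fin addr_ge0// mulr_ge0// sqr_ge0.
  - by apply/measurable_EFinP; apply: measurable_funD => //; exact: measurable_funM.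
  apply: filterS2 TA T00 => x Tx T0x _; rewrite lee_fin.
  move: T0x; rewrite normr_le0 => /eqP ->; rewrite subr0.
  have T2 : T h x ^+ 2 <= sigma0 ^+ 2 / 4.
    rewrite -[leLHS]ger0_norm ?sqr_ge0// normrX.
    have -> : sigma0 ^+ 2 / 4 = (sigma0 / 2) ^+ 2 by field.
    by rewrite ler_sqr ?nnegrE ?divr_ge0 ?(ltW s0)// (le_trans Tx).
  have vsV : (v x)^-1 <= (sigma0 ^+ 2)^-1.
    by rewrite lef_pV2 ?posrE ?exprn_gt0.
  have uE : T h x ^+ 2 / v x <= T h x ^+ 2 / sigma0 ^+ 2 by rewrite ler_wpM2l ?sqr_ge0.
  apply: (le_trans (expR_le_1D2x _ _ _)).
  - by rewrite divr_ge0 ?sqr_ge0// ltW.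
  - apply: (le_trans uE); rewrite ler_pdivrMr ?exprn_gt0//.
    by apply: (le_trans T2); have := sqr_ge0 sigma0; lra.
  - have -> : c * T h x ^+ 2 = 2 * (T h x ^+ 2 / sigma0 ^+ 2) by rewrite /c; ring.
    by rewrite lerD2l ler_pM2l.
under eq_integral do rewrite EFinD.
rewrite ge0_integralD//; last 2 first.
- by move=> x _; rewrite lee_fin mulr_ge0// sqr_ge0.
- by apply/measurable_EFinP; exact: measurable_funM.
rewrite integral_cst// mul1e.
under eq_integral do rewrite EFinM.
rewrite ge0_integralZl//; last 2 first.
- exact/measurable_EFinP.
- by move=> x _; rewrite lee_fin sqr_ge0.
have -> : (\int[distribution Pr X]_x ((T h x) ^+ 2)%:E =
    'N[distribution Pr X]_2%:E[EFin \o T h] `^ 2)%E.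
  rewrite poweR_Lnorm//; apply: eq_integral => x _.
  by rewrite /= powR_mulrn// -normrX ger0_norm// sqr_ge0.
have : ('N[distribution Pr X]_2%:E[EFin \o T h] `^ 2 <= (B ^+ 2)%:E)%E.
  rewrite -powR_mulrn// -poweR_EFin; apply: gt0_ler_poweR => //.
  - by rewrite in_itv/= leey andbT Lnorm_ge0.
  - by rewrite in_itv/= leey andbT lee_fin.
move=> /(lee_wpmul2l (_ : 0 <= c%:E)%E); rewrite lee_fin => /(_ c0) HN.
apply: (@le_trans _ _ (1 + c%:E * (B ^+ 2)%:E)%E).
  by apply: leeD HN; exact: (probability_le1 (distribution Pr X) measurableT).

(* Back to an exponential, whose [n]-th power just multiplies the exponent by [n]. *)
by rewrite -EFinM -EFinD lee_fin; exact: expR_ge1Dx.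
Qed.
(** * Finite differences and bumps *)

Section truncated_powers.
Context {R : realType}.
Implicit Types (x w C : R) (a c r : nat).

Definition pospart x : R := Num.max x 0.

Let pospart_ge0 x : 0 <= pospart x.
Proof. by rewrite /pospart le_max lexx orbT. Qed.

Let continuous_pospart : continuous pospart.
Proof.
move=> x; apply: (@continuous_max _ _ id (cst 0)); [exact: cvg_id|exact: cvg_cst].
Qed.

Let continuous_pospartX n : continuous (fun x => pospart x ^+ n).
Proof.
move=> x; apply: (@continuous_comp _ _ _ pospart (fun y => y ^+ n)).
  exact: continuous_pospart.
exact: exprn_continuous.
Qed.

(** At 0 the difference quotient is [pospart h ^ a.+1], which tends to 0 because the exponent is
    positive. *)
Lemma is_derive_pospartX a x :
  is_derive x (1 : R) (fun x => pospart x ^+ a.+2) (a.+2%:R * pospart x ^+ a.+1).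
Proof.
have [x0|x0|->] := ltgtP x 0.
- apply: (@near_eq_is_derive _ _ _ (cst 0)).
    near=> y; rewrite /pospart max_r ?expr0n// ltW//; near: y.
    exact: lt_nbhsl.
  by rewrite /pospart max_r ?expr0n ?mulr0 ?ltW//; exact: is_derive_cst.
- apply: (@near_eq_is_derive _ _ _ (fun x => x ^+ a.+2)).
    near=> y; rewrite /pospart max_l// ltW//; near: y.
    exact: lt_nbhsr.
  rewrite /pospart max_l ?ltW//.
  have := is_deriveX a.+2 (is_derive_id x (1 : R)).
  by rewrite exprfctE /GRing.scale/= mulr1.
- rewrite {2}/pospart maxxx expr0n mulr0.
  have H : (fun h : R => h^-1 *: (pospart (h *: 1 + 0) ^+ a.+2 - pospart 0 ^+ a.+2))
      @ 0^' --> (0 : R).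
    have K : (fun h => pospart h ^+ a.+1) @ 0^' --> (0 : R).
      have := continuous_pospartX a.+1 0.
      by rewrite /continuous_at {2}/pospart maxxx expr0n; exact: cvg_within_filter.
    apply: cvg_trans K; apply: near_eq_cvg; near=> h.
    have h0 : h != 0 by near: h; exact: nbhs_dnbhs_neq.
    rewrite addr0 [h *: 1]mulr1 {3}/pospart maxxx expr0n subr0.
    rewrite /GRing.scale/= /pospart; have [h1|h1] := leP h 0.
      by rewrite !expr0n/= mulr0.
    by rewrite (exprS h a.+1) mulKf.
  by apply: DeriveDef; [apply/cvg_ex; exists 0|exact/cvg_lim].
Unshelve. all: by end_near. Qed.

(** A bump on [[0,1]] of finite smoothness: its derivative is a combination of two functions of the
    same family, with one exponent lowered, so derivatives are bounded by a plain induction. *)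
Definition tent a c x : R := pospart x ^+ a * pospart (1 - x) ^+ c.

Lemma tent_ge0 a c x : 0 <= tent a c x.
Proof. by rewrite mulr_ge0// exprn_ge0. Qed.

Lemma tent_le1 a c x : (0 < a)%N -> (0 < c)%N -> tent a c x <= 1.
Proof.
move=> a0 c0; rewrite /tent /pospart; have [x0|x0] := leP x 0.
  by rewrite expr0n gtn_eqF// mul0r.
have [x1|x1] := leP (1 - x) 0; first by rewrite expr0n gtn_eqF// mulr0.
rewrite mulr_ile1 ?exprn_ge0 ?exprn_ile1 ?ltW//; lra.
Qed.

Lemma tent0 a c x : (0 < a)%N -> (0 < c)%N -> ~~ (0 < x < 1) -> tent a c x = 0.
Proof.
move=> a0 c0; rewrite negb_and -!leNgt /tent /pospart => /orP[x0|x1].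
  by rewrite max_r// expr0n gtn_eqF// mul0r.
by rewrite [Num.max (1 - x) 0]max_r ?subr_le0// (expr0n _ c) gtn_eqF// mulr0.
Qed.

Lemma tent_gt0 a c x : 0 < x < 1 -> 0 < tent a c x.
Proof.
by move=> /andP[x0 x1]; rewrite mulr_gt0// exprn_gt0// lt_max ?subr_gt0 ?x0 ?x1.
Qed.

Lemma is_derive_tent a c x : is_derive x (1 : R) (tent a.+2 c.+2)
  (a.+2%:R * tent a.+1 c.+2 x - c.+2%:R * tent a.+2 c.+1 x).
Proof.
have h1 := is_derive_pospartX a x.
have h2 := is_derive_pospartX c (1 - x).
have h3 : is_derive x (1 : R) (fun x : R => 1 - x) (-1).
  have := is_deriveB (is_derive_cst (1 : R) x (1 : R)) (is_derive_id x (1 : R)).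
  by rewrite sub0r.
have h4 := @is_derive1_comp _ (fun x => pospart x ^+ c.+2) (fun x : R => 1 - x) x _ _ h2 h3.
have := is_deriveM h1 h4; rewrite /tent => /is_derive_eq; apply.
by rewrite /GRing.scale/=; ring.
Qed.

Lemma continuous_tent a c : continuous (tent a c).
Proof.
move=> x; apply: cvgM; first exact: continuous_pospartX.
apply: (@continuous_comp _ _ _ (fun x : R => 1 - x) (fun y => pospart y ^+ c)).
  by apply: cvgB; [exact: cvg_cst|exact: cvg_id].
exact: continuous_pospartX.
Qed.

Fixpoint derivatives_bounded r C (f : R -> R) : Prop :=
  (forall x, `|f x| <= C) /\
  if r is r'.+1 then exists2 f' : R -> R,
    (forall x, is_derive x (1 : R) f (f' x)) & derivatives_bounded r' C f'
  else True.

Lemma derivatives_bounded_le r C C' f :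
  C <= C' -> derivatives_bounded r C f -> derivatives_bounded r C' f.
Proof.
move=> CC'; elim: r f => [|r IH] f /= [fC H]; split=> //; try by
  move=> x; exact: le_trans (fC x) CC'.
by case: H => f' Hf' Hb; exists f' => //; exact: IH.
Qed.

Lemma derivatives_bounded_comb r C C' (s t : R) f g :
  derivatives_bounded r C f -> derivatives_bounded r C' g ->
  derivatives_bounded r (`|s| * C + `|t| * C') (fun x => s * f x - t * g x).
Proof.
elim: r f g => [|r IH] f g /= [fC Hf] [gC Hg].
  split=> // x; rewrite (le_trans (ler_normB _ _))// !normrM.
  by rewrite lerD ?ler_wpM2l.
split.
  move=> x; rewrite (le_trans (ler_normB _ _))// !normrM.
  by rewrite lerD ?ler_wpM2l.
case: Hf => f' f'E Hf'; case: Hg => g' g'E Hg'.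
exists (fun x => s * f' x - t * g' x); last exact: IH.
move=> x; have hf := is_deriveZ s (f'E x); have hg := is_deriveZ t (g'E x).
exact: (is_deriveB hf hg).
Qed.

(** Each derivative lowers one exponent by one; [r < a] and [r < c] keep both positive down to order
    0, where [tent_le1] applies. *)
Lemma derivatives_bounded_tent r a c : (r < a)%N -> (r < c)%N ->
  exists C, derivatives_bounded r C (tent a c).
Proof.
elim: r a c => [|r IH] a c ra rc.
  exists 1; split=> // x; rewrite ger0_norm ?tent_ge0// tent_le1//.
case: a ra => [//|[//|a]] ra; case: c rc => [//|[//|c]] rc.
have [C1 H1] := IH a.+1 c.+2 ra (ltnW rc).
have [C2 H2] := IH a.+2 c.+1 (ltnW ra) rc.
set C := `|a.+2%:R : R| * C1 + `|c.+2%:R : R| * C2.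
exists (Num.max 1 C); split.
  move=> x; rewrite ger0_norm ?tent_ge0// le_max tent_le1//.
exists (fun x => a.+2%:R * tent a.+1 c.+2 x - c.+2%:R * tent a.+2 c.+1 x).
  exact: is_derive_tent.
apply: (@derivatives_bounded_le _ C); first by rewrite le_max lexx orbT.
exact: derivatives_bounded_comb.
Qed.

End truncated_powers.

(** * Calculus of iterated differences *)

Section finite_differences.
Context {R : realType} {V : zmodType}.
Implicit Types (u v : V) (f g : V -> R) (C e : R).

Definition delta v f : V -> R := fun y => f (y + v) - f y.

Lemma iter_deltaD j v f g y :
  iter j (delta v) (fun x => f x + g x) y =
  iter j (delta v) f y + iter j (delta v) g y.
Proof.
by elim: j y => [//|j IH] y; rewrite !iterS /delta !IH; ring.
Qed.

Lemma iter_deltaZ j v f C y :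
  iter j (delta v) (fun x => C * f x) y = C * iter j (delta v) f y.
Proof.
by elim: j y => [//|j IH] y; rewrite !iterS /delta !IH; ring.
Qed.

Lemma iter_delta_shift j v f u y :
  iter j (delta v) (fun x => f (x + u)) y = iter j (delta v) f (y + u).
Proof.
by elim: j y => [//|j IH] y; rewrite !iterS /delta !IH addrAC.
Qed.

(** Lets the difference taken in a modulus of smoothness act on the bump itself, inside the
    difference that defines [diff_bump]. *)
Lemma iter_delta_comm i j u v f y :
  iter i (delta u) (iter j (delta v) f) y =
  iter j (delta v) (iter i (delta u) f) y.
Proof.
elim: i y => [//|i IH] y; rewrite iterS [LHS]/delta !IH.
have -> : iter i.+1 (delta u) f =
    fun x => iter i (delta u) f (x + u) + -1 * iter i (delta u) f x.
  by apply/funext => x; rewrite mulN1r.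
by rewrite iter_deltaD iter_deltaZ iter_delta_shift mulN1r.
Qed.

Lemma iter_delta_le j v f C y : (forall x, `|f x| <= C) ->
  `|iter j (delta v) f y| <= 2 ^+ j * C.
Proof.
move=> fC; elim: j y => [|j IH] y; first by rewrite mul1r.
rewrite iterS /delta (le_trans (ler_normB _ _))// exprS -mulrA mulrDl !mul1r.
exact: lerD.
Qed.

(** Discrete form of bounds on [r] derivatives; [e] is the length of the step [v] relative to the
    scale of [f]. *)
Definition diffs_bounded (r : nat) v C e f :=
  forall j, (j <= r)%N -> forall y, `|iter j (delta v) f y| <= C * e ^+ j.

(** Leibniz rule: the difference of [f g] is [delta f * g (x + v) + f * delta g], and each order
    doubles the number of terms. The induction varies [C] and [C'], since [delta v f] is bounded
    with [C * e]. *)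
Lemma diffs_boundedM r v C C' e f g : 0 <= C -> 0 <= C' -> 0 <= e ->
  diffs_bounded r v C e f -> diffs_bounded r v C' e g ->
  diffs_bounded r v (2 ^+ r * C * C') e (fun x => f x * g x).
Proof.
move=> C0 C0' e0 Hf Hg j jr y.
apply: (@le_trans _ _ (2 ^+ j * C * C' * e ^+ j)); last first.
  by do 3! (rewrite ler_wpM2r ?exprn_ge0//); rewrite ler_weXn2l// ler1n.
have {}Hf i : (i <= j)%N -> forall y, `|iter i (delta v) f y| <= C * e ^+ i.
  by move=> ij; apply: Hf; exact: leq_trans jr.
have {}Hg i : (i <= j)%N -> forall y, `|iter i (delta v) g y| <= C' * e ^+ i.
  by move=> ij; apply: Hg; exact: leq_trans jr.
elim: j {jr} y C C' C0 C0' f g Hf Hg => [|j IH] y C C' C0 C0' f g Hf Hg.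
  rewrite /= normrM mul1r mulr1.
  by have := Hf 0%N isT y; have := Hg 0%N isT y; rewrite /= !mulr1 => ? ?; exact: ler_pM.
rewrite iterSr.
have -> : delta v (fun x => f x * g x) =
    (fun x => delta v f x * g (x + v) + f x * delta v g x).
  by apply/funext => x; rewrite /delta; ring.
rewrite iter_deltaD (le_trans (ler_normD _ _))//.
have H1 := IH y (C * e) C' (mulr_ge0 C0 e0) C0' (delta v f) (fun x => g (x + v)).
have H2 := IH y C (C' * e) C0 (mulr_ge0 C0' e0) f (delta v g).
rewrite [leRHS](_ : _ = 2 ^+ j * (C * e) * C' * e ^+ j +
    2 ^+ j * C * (C' * e) * e ^+ j); last first.
  by rewrite !exprS; ring.
apply: lerD; [apply: H1|apply: H2] => i ij x.
- by rewrite -iterSr -mulrA -exprS; exact: Hf.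
- by rewrite iter_delta_shift; apply: Hg; exact: leqW.
- by apply: Hf; exact: leqW.
- by rewrite -iterSr -mulrA -exprS; exact: Hg.
Qed.

Lemma diffs_bounded1 r v e : 0 <= e -> diffs_bounded r v 1 e (fun=> 1).
Proof.
move=> e0 j _ y; case: j => [|j]; first by rewrite /= normr1 mulr1.
rewrite iterSr; have -> : delta v (fun=> 1) = (fun=> 0 * 0).
  by apply/funext => x; rewrite /delta subrr mul0r.
by rewrite iter_deltaZ mul0r normr0 mulr_ge0// exprn_ge0.
Qed.

Lemma diffs_bounded_prod r v C e (s : nat) (f : 'I_s -> V -> R) :
  0 <= C -> 0 <= e -> (forall i, diffs_bounded r v C e (f i)) ->
  diffs_bounded r v ((2 ^+ r * C) ^+ s) e (fun x => \prod_(i < s) f i x).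
Proof.
move=> C0 e0; elim: s f => [|s IH] f Hf.
  rewrite expr0; have -> : (fun x => \prod_(i < 0) f i x) = fun=> 1.
    by apply/funext => x; rewrite big_ord0.
  exact: diffs_bounded1.
have -> : (fun x => \prod_(i < s.+1) f i x) =
    (fun x => f ord0 x * \prod_(i < s) f (lift ord0 i) x).
  by apply/funext => x; rewrite big_ord_recl.
rewrite exprS; apply: diffs_boundedM => //.
  by rewrite exprn_ge0// mulr_ge0// exprn_ge0.
exact: IH.
Qed.

End finite_differences.

Lemma iter_delta_comp {R : realType} {V W : zmodType} (L : W -> V) (w : W) (v : V)
    (f : V -> R) j y :
  (forall x, L (x + w) = L x + v) ->
  iter j (delta w) (fun x => f (L x)) y = iter j (delta v) f (L y).
Proof.
by move=> HL; elim: j y => [//|j IH] y; rewrite !iterS /delta !IH HL.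
Qed.

Lemma is_derive_iter_delta {R : realType} (f f' : R -> R) (w x : R) j :
  (forall x, is_derive x (1 : R) f (f' x)) ->
  is_derive x (1 : R) (iter j (delta w) f) (iter j (delta w) f' x).
Proof.
move=> Hf; elim: j x => [//|j IH] x; rewrite !iterS.
have h1 := @is_derive1_comp _ (iter j (delta w) f) (shift w) x _ _
  (IH (x + w)) (is_derive_shift x (1 : R) w).
by have := is_deriveB h1 (IH x); rewrite mulr1.
Qed.

(** Mean value theorem: the derivative of the [j]-th difference of [f] is the [j]-th difference of
    [f'], bounded by induction with one derivative fewer. *)
Lemma derivatives_bounded_delta {R : realType} (r : nat) (C w : R) (f : R -> R) :
  derivatives_bounded r C f -> diffs_bounded r w C `|w| f.
Proof.
move=> Hf j jr y.
elim: j r jr f Hf y => [|j IH] r jr f Hf y.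
  by rewrite mulr1; case: r Hf {jr} => [|r] [].
case: r jr Hf => // r jr [_ [f' f'E Hf']].
rewrite iterS /delta.
have HD x := is_derive_iter_delta f f' w x j f'E.
have cD : continuous (iter j (delta w) f).
  by move=> x; have [+ _] := HD x; move=> /derivable1_diffP/differentiable_continuous.
have lip a b : a <= b -> `|iter j (delta w) f b - iter j (delta w) f a| <=
    C * `|w| ^+ j * (b - a).
  move=> ab.
  have [c _ ->] := MVT_segment ab (fun x _ => HD x) (continuous_subspaceT cD).
  rewrite normrM [`|b - a|]ger0_norm ?subr_ge0// ler_wpM2r ?subr_ge0//.
  exact: (IH r).
(* [lip] wants ordered endpoints, so the sign of [w] decides which of [y] and [y + w] comes
   first. *)
rewrite exprS [`|w| * _]mulrC mulrA; have [w0|w0] := leP 0 w.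
  rewrite [X in _ * X]ger0_norm//; have := lip y (y + w).
  by rewrite lerDl [y + w - y]addrAC subrr add0r; apply.
rewrite distrC [X in _ * X]ltr0_norm//; have := lip (y + w) y.
by rewrite gerDl opprD addNKr; apply; exact: ltW.
Qed.
(** Pascal's rule: the terms in [g k.+1] and [g k] recombine, and ['C(r, r.+1) = 0] closes the
    shifted sum. *)
Lemma fdiff_iter_delta {R : realType} {d : nat} (r : nat) (v : 'rV[R]_d)
    (f : 'rV[R]_d -> R) (y : 'rV[R]_d) :
  fdiff r v f y = iter r (delta v) f y.
Proof.
elim: r f y => [|r IH] f y.
  by rewrite /fdiff big_ord_recl big_ord0 addr0 /= scale0r addr0 bin0 !mul1r.
rewrite iterSr -IH /fdiff /delta.
pose g k := f (y + k%:R *: v).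
have gS k : f (y + k%:R *: v + v) = g k.+1.
  by rewrite /g -addrA -{2}[v]scale1r -scalerDl -natr1.
transitivity (\sum_(k < r.+1) (-1) ^+ (r - k) * 'C(r, k)%:R * (g k.+1 - g k));
    last by apply: eq_bigr => k _; rewrite -gS.
pose s (k : nat) : R := (-1) ^+ (r - k).
rewrite big_ord_recl/= subn0 bin0 mulr1.
rewrite (eq_bigr (fun k : 'I_r.+1 => s k * 'C(r, k.+1)%:R * g k.+1 + s k * 'C(r, k)%:R * g k.+1));
  last by move=> k _; rewrite /bump/= add1n subSS binS natrD /s /g; ring.
under [RHS]eq_bigr do rewrite mulrBr.
rewrite big_split/= [RHS]big_split/= addrA addrC; congr (_ + _).
rewrite sumrN [in RHS]big_ord_recl/= subn0 bin0 mulr1.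
rewrite [in LHS]big_ord_recr/= bin_small// mulr0 mul0r addr0 opprD.
rewrite exprS mulN1r mulNr -sumrN; congr (_ + _).
apply: eq_bigr => k _; rewrite /s /bump/= add1n -[(r - k)%N]subSS subSn//.
by rewrite exprS; ring.
Qed.


Lemma measurable_coord {R : realType} {n : nat} (i : 'I_n) :
  measurable_fun setT (fun y : 'rV[R]_n => y ord0 i).
Proof.
move=> _ B mB; rewrite setTI; apply: sub_sigma_algebra => /=.
rewrite -bigcup_seq/=; exists i => /=; first by rewrite mem_index_enum.
by exists B => //; rewrite setTI.
Qed.

Lemma measurable_rV_of_coord {d0} {T : measurableType d0} {R : realType}
    {n : nat} (f : T -> 'rV[R]_n) :
  (forall i, measurable_fun setT (fun t => f t ord0 i)) -> measurable_fun setT f.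
Proof.
move=> mf; apply: measurability => //= _ [B + <-].
rewrite -bigcup_seq => -[i /= _ [C mC <-]].
rewrite !setTI -comp_preimage -[X in measurable X]setTI.
exact: (mf i measurableT _ mC).
Qed.

Lemma norm_coord_le {R : realType} {n : nat} (y : 'rV[R]_n) i :
  `|y ord0 i| <= `|y|.
Proof.
rewrite [leRHS]/Num.Def.normr /= mx_normrE.
by apply/bigmax_geP; right => /=; exists (ord0, i).
Qed.

Definition cell_bump {R : realType} {d : nat} (K : nat) (e : R) (z y : 'rV[R]_d) :=
  \prod_(i < d) tent K K (y ord0 i / e - z ord0 i).

(* The adjoint of the r-th difference of step e (1, .., 1), applied to a bump
   of height A supported by the cell of side e with lowest corner e z. *)
Definition diff_bump {R : realType} {d : nat} (K r : nat) (e A : R)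
    (z : 'rV[R]_d) : 'rV[R]_d -> R :=
  iter r (delta (- const_mx e)) (fun y => A * cell_bump K e z y).

Section bump.
Context {R : realType} {d : nat}.
Implicit Types (A e p : R) (z y v : 'rV[R]_d) (K r : nat).

Lemma cell_bump_ge0 K e z y : 0 <= cell_bump K e z y.
Proof. by apply: prodr_ge0 => i _; exact: tent_ge0. Qed.

Lemma cell_bump_le1 K e z y : (0 < K)%N -> cell_bump K e z y <= 1.
Proof.
by move=> K0; apply: prodr_ile1 => i _; rewrite tent_ge0 tent_le1.
Qed.

Lemma cell_bump_neq0 K e z y : (0 < K)%N -> 0 < e -> cell_bump K e z y != 0 ->
  forall i, z ord0 i * e < y ord0 i < (z ord0 i + 1) * e.
Proof.
move=> K0 e0 yz i.
have : 0 < y ord0 i / e - z ord0 i < 1.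
  apply: contraNT yz => yzi; rewrite /cell_bump (bigD1 i)//= tent0// mul0r//.
by rewrite subr_gt0 ltrBlDr ltr_pdivlMr// ltr_pdivrMr// [1 + _]addrC.
Qed.

Lemma continuous_cell_bump K e z : continuous (cell_bump K e z).
Proof.
rewrite /cell_bump; elim: (index_enum _) => [|i s IH].
  rewrite [X in continuous X](_ : _ = cst 1); first exact: cst_continuous.
  by apply/funext => y; rewrite big_nil.
rewrite [X in continuous X](_ : _ = fun y => tent K K (y ord0 i / e - z ord0 i) *
    \prod_(j <- s) tent K K (y ord0 j / e - z ord0 j)); last first.
  by apply/funext => y; rewrite big_cons.
move=> y; pose L (y : 'rV[R]_d) := y ord0 i / e - z ord0 i.
have cL : L @ y --> L y.
  have cc : (fun y : 'rV[R]_d => y ord0 i) @ y --> y ord0 i.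
    exact: coord_continuous.
  exact: (cvgB (cvgM cc (cvg_cst e^-1)) (cvg_cst (z ord0 i))).
have cT : (tent K K \o L) @ y --> tent K K (L y).
  exact: (continuous_comp cL (@continuous_tent _ K K (L y))).
exact: (cvgM cT (IH y)).
Qed.

Lemma measurable_cell_bump K e z : measurable_fun setT (cell_bump K e z).
Proof.
apply: measurable_prod => i _.
apply: (measurableT_comp (continuous_measurable_fun (@continuous_tent _ K K))).
apply: measurable_funB => //; apply: measurable_funM => //.
exact: measurable_coord.
Qed.

Lemma continuous_iter_delta r v (f : 'rV[R]_d -> R) :
  continuous f -> continuous (iter r (delta v) f).
Proof.
move=> cf; elim: r => [//|r IH] y; rewrite iterS /delta.
have cS : (fun y => y + v) @ y --> y + v.
  exact: (cvgD cvg_id (cvg_cst v)).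
have cT : (iter r (delta v) f \o +%R^~ v) @ y --> iter r (delta v) f (y + v).
  exact: (continuous_comp cS (IH (y + v))).
exact: (cvgB cT (IH y)).
Qed.

Lemma measurable_translation v : measurable_fun setT (fun y => y + v).
Proof.
apply: measurable_rV_of_coord => i.
rewrite (_ : (fun t => _) = fun t : 'rV[R]_d => t ord0 i + v ord0 i); last first.
  by apply/funext => t; rewrite mxE.
by apply: measurable_funD => //; exact: measurable_coord.
Qed.

Lemma measurable_iter_delta r v (f : 'rV[R]_d -> R) :
  measurable_fun setT f -> measurable_fun setT (iter r (delta v) f).
Proof.
move=> mf; elim: r => [//|r IH]; rewrite iterS /delta.
by apply: measurable_funB => //; apply: measurableT_comp => //; exact: measurable_translation.
Qed.

Lemma measurable_diff_bump K r e A z : measurable_fun setT (diff_bump K r e A z).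
Proof.
apply: measurable_iter_delta; apply: measurable_funM => //.
exact: measurable_cell_bump.
Qed.

Lemma continuous_diff_bump K r e A z : continuous (diff_bump K r e A z).
Proof.
apply: continuous_iter_delta => y.
exact: (cvgM (cvg_cst A) (@continuous_cell_bump K e z y)).
Qed.

Lemma diff_bump_le K r e A z y : (0 < K)%N -> 0 <= A ->
  `|diff_bump K r e A z y| <= 2 ^+ r * A.
Proof.
move=> K0 A0; apply: iter_delta_le => x.
by rewrite ger0_norm ?mulr_ge0 ?cell_bump_ge0// ler_piMr ?cell_bump_le1.
Qed.

(** For [|v| <= e] the difference is of order [(|v| / e) ^ m], at most [(|v| / e) ^ p]; for
    [|v| > e] the trivial bound [2 ^ m] is enough. *)
Lemma iter_delta_cell_bump_le K m : (m < K)%N -> exists2 C, 0 < C &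
  forall p e z v y, 0 <= p <= m%:R -> 0 < e ->
  `|iter m (delta v) (cell_bump K e z) y| <= C * (`|v| / e) `^ p.
Proof.
move=> mK; have [C0 HC0] := @derivatives_bounded_tent R m K K mK mK.
pose C1 := Num.max 1 C0.
have HC : derivatives_bounded m C1 (tent K K : R -> R).
  by apply: derivatives_bounded_le HC0; rewrite le_max lexx orbT.
have C10 : 0 <= C1 by rewrite le_max ler01.
pose D := (2 ^+ m * C1) ^+ d; exists (2 ^+ m * Num.max 1 D).
  by rewrite mulr_gt0// ?exprn_gt0// lt_max ltr01.
move=> p e z v y /andP[p0 pm] e0.
have ve0 : 0 <= `|v| / e by rewrite divr_ge0// ltW.
have m1 : 1 <= 2 ^+ m :> R by rewrite exprn_ege1// ler1n.
have [ve1|ve1] := leP (`|v| / e) 1.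
  apply: (@le_trans _ _ (D * (`|v| / e) ^+ m)).
    apply: diffs_bounded_prod => // i j jm x.
    rewrite (iter_delta_comp (fun y : 'rV[R]_d => y ord0 i / e - z ord0 i) v
      (v ord0 i / e) (tent K K)); last first.
      by move=> t; rewrite mxE mulrDl addrAC.
    apply: (le_trans (derivatives_bounded_delta _ _ (v ord0 i / e) _ HC _ jm _)).
    rewrite ler_wpM2l// lerXn2r ?nnegrE// normrM normfV (gtr0_norm e0).
    by rewrite ler_wpM2r ?invr_ge0 ?(ltW e0)// norm_coord_le.
  have D0 : 0 <= D by rewrite exprn_ge0// mulr_ge0// exprn_ge0.
  apply: ler_pM => //; first by rewrite exprn_ge0.
    by rewrite -[leLHS]mul1r ler_pM// le_max lexx orbT.
  (* Comparing exponents takes a positive base; at 0, [powR] is 1 for exponent 0 and 0 otherwise. *)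
  rewrite -powR_mulrn//; have [ve0'|ve0'] := eqVneq (`|v| / e) 0.
    rewrite ve0' {1}/powR eqxx; case: eqP => [m0|_]; last exact: powR_ge0.
    have -> : p = 0 by apply: le_anti; rewrite p0 -m0 pm.
    by rewrite powRr0.
  by apply: ger_powR => //; rewrite lt_def ve0' ve0 ve1.
apply: (@le_trans _ _ (2 ^+ m * 1)).
  apply: iter_delta_le => x.
  by rewrite ger0_norm ?cell_bump_ge0// cell_bump_le1// (leq_ltn_trans _ mK).
rewrite -mulrA ler_wpM2l ?exprn_ge0// -[leLHS]mulr1 ler_pM// ?le_max ?lexx//.
have := @ge0_ler_powR R _ p0 1 (`|v| / e).
by rewrite !nnegrE powR1; apply=> //; exact: ltW.
Qed.

End bump.
(** * Lebesgue measure on the cube *)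

Section uniform_cube.
Context {R : realType}.
Local Notation RT := (measurableTypeR R).
Local Notation U := (uniform_prob (@ltr01 R)).
Local Open Scope ereal_scope.

Definition shift_tuple {n} (w : R) (t : n.-tuple RT) : n.-tuple RT :=
  [tuple (tnth t i + w)%R : RT | i < n].

Lemma measurable_shift_tuple n (w : R) :
  measurable_fun setT (@shift_tuple n w).
Proof.
apply/measurable_fun_tnthP => i.
rewrite (_ : _ \o _ = fun t : n.-tuple RT => (tnth t i + w)%R : RT); last first.
  by apply/funext => t /=; rewrite tnth_mktuple.
apply: (@measurable_funD _ _ _ _ (fun t : n.-tuple RT => tnth t i : R) (fun=> w)) => //.
exact: measurable_tnth.
Qed.

Lemma shift_tcons n (w x : R) (t : n.-tuple RT) :
  shift_tuple w (tcons (x : RT, t)) = tcons ((x + w)%R : RT, shift_tuple w t).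
Proof.
apply: eq_from_tnth => i; rewrite tnth_mktuple.
case: (unliftP ord0 i) => [j|] ->; last by rewrite !tnth0.
by rewrite !tnthS tnth_mktuple.
Qed.

(** Since [f] lives on [[w, 1]], both integrals extend to the whole line, where translation is
    harmless. *)
Lemma ge0_integral_uniform_shift (w : R) (f : R -> \bar R) :
  measurable_fun setT f -> (forall x, 0 <= f x) -> (0 <= w)%R ->
  (forall x, ~~ (w <= x <= 1)%R -> f x = 0) ->
  \int[U]_x f (x + w)%R = \int[U]_x f x.
Proof.
move=> mf f0 w0 fw.
have mfw : measurable_fun setT (fun x : R => f (x + w)%R).
  by apply: measurableT_comp => //; exact: measurable_funD.
rewrite !integral_uniform// subr0 invr1 !mul1e.
transitivity (\int[lebesgue_measure]_x f (x + w)%R).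
  rewrite integral_mkcond; apply: eq_integral => x _.
  rewrite patchE; case: ifPn => // /negP H; apply/esym/fw; apply/negP => /andP[h1 h2].
  by apply: H; rewrite inE/= in_itv/=; apply/andP; split; lra.
rewrite ge0_integral_shift// [RHS]integral_mkcond; apply: eq_integral => x _.
rewrite patchE; case: ifPn => // /negP H; apply/fw; apply/negP => /andP[h1 h2].
by apply: H; rewrite inE/= in_itv/=; apply/andP; split; lra.
Qed.

(** One coordinate at a time by Tonelli; the inner integral again vanishes off [[w, 1]]. *)
Lemma ge0_integral_iid_shift n (w : R) (f : n.-tuple RT -> \bar R) :
  measurable_fun setT f -> (forall t, 0 <= f t) -> (0 <= w)%R ->
  (forall t i, ~~ (w <= tnth t i <= 1)%R -> f t = 0) ->
  \int[iid U n]_t f (shift_tuple w t) = \int[iid U n]_t f t.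
Proof.
move=> + + w0; elim: n f => [|n IH] f mf f0 fw.
  by apply: eq_integral => t _; congr f; rewrite tuple0 [RHS]tuple0.
have mfw : measurable_fun setT (fun t => f (shift_tuple w t)).
  by apply: measurableT_comp => //; exact: measurable_shift_tuple.
have mt : measurable_fun setT (@tcons _ RT n) by exact: measurable_tcons.
rewrite /= !ge0_integral_distribution//.
have mG g : measurable_fun setT g -> measurable_fun setT (g \o @tcons _ RT n : _ -> \bar R).
  by move=> mg; exact: measurableT_comp.
rewrite !fubini_tonelli1//; try (exact: mG); try (move=> z; exact: f0).
pose H (x : R) := \int[iid U n]_t f (tcons (x : RT, t)).
transitivity (\int[U]_x H (x + w)%R).
  apply: eq_integral => x _; rewrite /fubini_F/=.
  under eq_integral do rewrite shift_tcons.
  apply: IH => //.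
  - exact: (measurableT_comp (mG _ mf) (pair1_measurable ((x + w)%R : RT))).
  - move=> t i ti; apply: (fw _ (lift ord0 i)).
    by rewrite tnthS.
rewrite ge0_integral_uniform_shift//.
- exact: (measurable_fun_fubini_tonelli_F (f \o @tcons _ RT n) (mG _ mf) (fun z => f0 _)).
- by move=> x; exact: integral_ge0.
- move=> x xw; apply: integral0_eq => t _; apply: (fw _ ord0).
  by rewrite tnth0.
Qed.

Lemma measurable_box d0 (T : measurableType d0) n (B : 'I_n -> set T) :
  (forall i, measurable (B i)) ->
  measurable [set t : n.-tuple T | forall i, B i (tnth t i)].
Proof.
move=> mB.
rewrite (_ : [set t | _] = \bigcap_(i in [set: 'I_n]) (@tnth n T ^~ i) @^-1` B i); last first.
  by apply/seteqP; split => t /= H i; [move=> _; exact: H|exact: (H i Logic.I)].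
apply: fin_bigcap_measurable => // i _; rewrite -[X in measurable X]setTI.
exact: measurable_tnth.
Qed.

Lemma iid_box_le d0 (T : measurableType d0) (P : probability T R) n
    (B : 'I_n -> set T) (b : R) : (0 <= b)%R ->
  (forall i, measurable (B i)) -> (forall i, P (B i) <= b%:E) ->
  iid P n [set t | forall i, B i (tnth t i)] <= (b ^+ n)%:E.
Proof.
move=> b0; elim: n B => [|n IH] B mB Pb.
  by rewrite expr0; exact: (probability_le1 _ (measurable_box _ _ _ _ mB)).
pose B' (i : 'I_n) := B (lift ord0 i).
have -> : iid P n.+1 [set t | forall i, B i (tnth t i)] =
    (P \x iid P n) (B ord0 `*` [set t | forall i, B' i (tnth t i)]).
  rewrite /= /distribution /pushforward; congr (_ _).
  apply/seteqP; split => -[x t] /=.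
    move=> H; split; first by have := H ord0; rewrite tnth0.
    by move=> i; have := H (lift ord0 i); rewrite tnthS.
  move=> [Bx Bt] i; case: (unliftP ord0 i) => [j|] ->; last by rewrite tnth0.
  by rewrite tnthS; exact: Bt.
rewrite product_measure1E//; last by apply: measurable_box => i; exact: mB.
rewrite exprS EFinM; apply: lee_pmul => //; first exact: Pb.
by apply: IH => i; [exact: mB|exact: Pb].
Qed.

End uniform_cube.

Section lebesgue_cube.
Context {R : realType} {d : nat}.
Local Notation RT := (measurableTypeR R).
Local Notation U := (uniform_prob (@ltr01 R)).
Local Open Scope ereal_scope.

Lemma ge0_integral_cube_shift (w : R) (f : 'rV[R]_d -> \bar R) :
  measurable_fun setT f -> (forall y, 0 <= f y) -> (0 <= w)%R ->
  (forall (y : 'rV[R]_d) i, ~~ (w <= y ord0 i <= 1)%R -> f y = 0) ->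
  \int[lebesgue_cube R d]_y f (y + const_mx w)%R = \int[lebesgue_cube R d]_y f y.
Proof.
move=> mf f0 w0 fw.
have mfw : measurable_fun setT (fun y : 'rV[R]_d => f (y + const_mx w)%R).
  by apply: measurableT_comp => //; exact: measurable_translation.
rewrite !ge0_integral_distribution//.
rewrite -(ge0_integral_iid_shift d w (f \o @row_of_tuple R d))//.
- apply: eq_integral => t _ /=; congr f; apply/rowP => i.
  by rewrite !mxE tnth_mktuple.
- by apply: measurableT_comp => //; exact: measurable_row_of_tuple.
- by move=> t; exact: f0.
- by move=> t i ti; apply: (fw _ i); rewrite mxE.
Qed.

Lemma integral_cube_shift (w : R) (f : 'rV[R]_d -> \bar R) :
  measurable_fun setT f -> (0 <= w)%R ->
  (forall (y : 'rV[R]_d) i, ~~ (w <= y ord0 i <= 1)%R -> f y = 0) ->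
  \int[lebesgue_cube R d]_y f (y + const_mx w)%R = \int[lebesgue_cube R d]_y f y.
Proof.
move=> mf w0 fw; rewrite [LHS]integralE [RHS]integralE; congr (_ - _).
- rewrite -(ge0_integral_cube_shift w f^\+)//.
  + by apply: eq_integral => y _; rewrite ?funeposE.
  + exact: measurable_funepos.
  + by move=> y i /fw; rewrite ?funeposE => ->; rewrite maxxx.
- rewrite -(ge0_integral_cube_shift w f^\-)//.
  + by apply: eq_integral => y _; rewrite ?funenegE.
  + exact: measurable_funeneg.
  + by move=> y i /fw; rewrite ?funenegE => ->; rewrite oppe0 maxxx.
Qed.

(** The box may stick out of the cube; the uniform density is at most 1, so each side contributes at
    most its length. *)
Lemma lebesgue_cube_box_le (a : 'I_d -> R) (e : R) : (0 <= e)%R ->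
  lebesgue_cube R d [set y : 'rV[R]_d | forall i, (a i < y ord0 i < a i + e)%R] <= (e ^+ d)%:E.
Proof.
move=> e0; pose B i : set RT := [set` `]a i, (a i + e)%R[].
have mB i : measurable (B i) by exact: measurable_itv.
have -> : lebesgue_cube R d [set y : 'rV[R]_d | forall i, (a i < y ord0 i < a i + e)%R] =
    iid U d [set t | forall i, B i (tnth t i)].
  rewrite /lebesgue_cube /distribution /pushforward; apply: (congr1 (iid U d)).
  apply/seteqP; split => t /= H i.
    by rewrite /B/= in_itv/=; move: (H i); rewrite mxE.
  by move: (H i); rewrite /B/= in_itv/= mxE.
apply: iid_box_le => // i.
rewrite [leLHS](_ : _ = \int[lebesgue_measure]_(x in B i) (uniform_pdf 0%R 1%R x)%:E)//.
rewrite integral_uniform_pdf.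
apply: (@le_trans _ _ (\int[lebesgue_measure]_(x in B i `&` `[0%R, 1%R]) 1)).
  apply: ge0_le_integral => //.
  - exact: measurableI.
  - by move=> x _; rewrite lee_fin uniform_pdf_ge0.
  - by apply/measurable_EFinP; apply: measurable_funTS; exact: measurable_uniform_pdf.
  - by move=> x _; rewrite lee_fin /uniform_pdf subr0 invr1; case: ifP.
rewrite integral_cst//; last exact: measurableI.
rewrite mul1e; apply: (@le_trans _ _ (lebesgue_measure (B i))).
  by apply: le_measure; rewrite ?inE//; exact: measurableI.
rewrite lebesgue_measure_itv/= lte_fin; case: ifP => _; last by rewrite lee_fin.
by rewrite -EFinD lee_fin addrAC subrr add0r.
Qed.

End lebesgue_cube.
(** * Norms of the perturbations *)

Lemma Lnormy_le {d0} {T : measurableType d0} {R : realType}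
    (mu : {measure set T -> \bar R}) (f : T -> \bar R) (B : R) : 0 <= B ->
  (forall y, `|f y| <= B%:E)%E -> ('N[mu]_+oo[f] <= B%:E)%E.
Proof.
move=> B0 fB; rewrite unlock /Lnorm; case: ifPn => _; last by rewrite lee_fin.
by apply/ess_supP; apply/aeW => y; exact: fB.
Qed.

Section diff_bump_norms.
Context {R : realType} {d : nat}.
Implicit Types (A e p s L : R) (z y v : 'rV[R]_d) (K r : nat).

(** A bump of side [e] and height [A] has smoothness norm of order [A / e ^ p]. The exponent of the
    tents is one more than the order [truncn p + 1] of the modulus, as their derivatives of that
    order must be bounded. *)
Lemma diff_bump_holder_ball p L r : 0 < p -> 0 < L -> exists2 a, 0 < a &
  forall e A z, 0 < e <= 1 -> 0 <= A <= a * e `^ p ->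
  holder_ball p L (diff_bump (Num.truncn p).+2 r e A z).
Proof.
move=> p0 L0; set m := (Num.truncn p).+1.
have [C C0 HC] := @iter_delta_cell_bump_le R d m.+1 m (ltnSn m).
have D0 : 0 < 2 ^+ r * (1 + C) by rewrite mulr_gt0 ?exprn_gt0// ltr_wpDl// ltW.
(* With this [a], [L] splits into [2 ^ r * a] for the sup norm and [2 ^ r * C * a] for the
   seminorm. *)
exists (L / (2 ^+ r * (1 + C))); first by rewrite divr_gt0.
set a := L / _ => e A z /andP[e0 e1] /andP[A0 Aa]; set h := diff_bump _ _ _ _ _.
have a0 : 0 < a by rewrite divr_gt0.
have pm : 0 <= p <= m%:R by rewrite !ltW// truncnS_gt.
split.
- exact: measurable_diff_bump.
- by apply: continuous_subspaceT; exact: continuous_diff_bump.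
rewrite /besov_norm p0 /besov_pos_norm.
have -> : L = 2 ^+ r * a + 2 ^+ r * C * a.
  have r0 : 0 < 2 ^+ r :> R by rewrite exprn_gt0.
  have C1 : 0 < 1 + C by rewrite addr_gt0.
  by rewrite /a; field; rewrite !gt_eqF.
clearbody a; rewrite EFinD; apply: leeD.
  apply: Lnormy_le => [|y]; first by rewrite mulr_ge0 ?exprn_ge0// ltW.
  rewrite /= lee_fin (le_trans (diff_bump_le _ _ _ _ _ _ _ _))// ler_wpM2l ?exprn_ge0//.
  apply: (le_trans Aa); rewrite ler_piMr ?(ltW a0)//.
  by have := @ge0_ler_powR R p (ltW p0) e 1; rewrite !nnegrE powR1 => ->//; exact: ltW.
apply: ge_ereal_sup => _ [t /= + <-]; rewrite in_itv/= => /andP[t0 t1].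
have tp0 : 0 < t `^ p by rewrite powR_gt0.
have ep0 : 0 < e `^ p by rewrite powR_gt0.
rewrite muleC -lee_pdivlMr ?powR_gt0//.
rewrite powRN invrK -EFinM; apply: ge_ereal_sup => _ [v /= vt <-].
apply: Lnormy_le => [|y].
  by rewrite mulr_ge0 ?powR_ge0// mulr_ge0 ?(ltW a0)// mulr_ge0 ?(ltW C0)// exprn_ge0.
rewrite /= lee_fin fdiff_iter_delta normrM -[leRHS]mul1r.
apply: ler_pM => //; first by rewrite indicE; case: (_ \in _); rewrite ?normr1 ?normr0.
rewrite /h /diff_bump iter_delta_comm.
apply: (@le_trans _ _ (2 ^+ r * (A * (C * (`|v| / e) `^ p)))).
  apply: iter_delta_le => x; rewrite iter_deltaZ normrM (ger0_norm A0).
  by rewrite ler_wpM2l// HC.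
rewrite -!mulrA ler_wpM2l ?exprn_ge0// mulrCA ler_wpM2l ?(ltW C0)//.
apply: (@le_trans _ _ (a * e `^ p * (t / e) `^ p)).
  apply: ler_pM => //; first exact: powR_ge0.
  rewrite ge0_ler_powR ?nnegrE ?(ltW p0) ?divr_ge0 ?(ltW e0) ?(ltW t0)//.
  by rewrite ler_wpM2r// invr_ge0 ltW.
have te0 : 0 <= t / e by rewrite divr_ge0 ?(ltW t0) ?(ltW e0).
by rewrite -mulrA -powRM ?(ltW e0)// mulrCA mulfV ?gt_eqF// mulr1.
Qed.

(* The center of the support of the term k = 0 of the difference. *)
Definition cell_center e z : 'rV[R]_d := \row_i ((z ord0 i + 2^-1) * e).

Let diff_bump_centerE K r e A z z' : 0 < e ->
  diff_bump K r e A z' (cell_center e z) = \sum_(k < r.+1)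
    (-1) ^+ (r - k) * 'C(r, k)%:R * (A * \prod_(i < d)
      tent K K (2^-1 - k%:R + (z ord0 i - z' ord0 i))).
Proof.
move=> e0; rewrite /diff_bump -fdiff_iter_delta /fdiff.
apply: eq_bigr => k _; congr (_ * (_ * _)); apply: eq_bigr => i _; congr tent.
by rewrite !mxE mulrN; field; rewrite gt_eqF.
Qed.

(** At the center the term [k = 0] evaluates the tent at 1/2, and the others at [1/2 - k < 0],
    outside its support. *)
Lemma diff_bump_center K r e A z : (0 < d)%N -> (0 < K)%N -> 0 < e -> 0 <= A ->
  `|diff_bump K r e A z (cell_center e z)| = A * tent K K 2^-1 ^+ d.
Proof.
move=> d0 K0 e0 A0; rewrite diff_bump_centerE// big_ord_recl/= bin0 mulr1.
rewrite [X in _ + X]big1 ?addr0.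
  rewrite normrM normrX normrN normr1 expr1n mul1r normrM ger0_norm//.
  under eq_bigr do rewrite subr0 subrr addr0.
  by rewrite prodr_const card_ord ger0_norm// exprn_ge0// tent_ge0.
move=> k _; rewrite (bigD1 (Ordinal d0))//= tent0 ?mul0r ?mulr0//.
rewrite subrr addr0 negb_and -!leNgt /bump/= add1n -[k.+1%:R]natr1; apply/orP; left.
by have : 0 <= k%:R :> R by []; lra.
Qed.

(** The translates reach [r] units beyond the cell of the bump; [r + 1] units of separation push
    [1/2 - k + (z - z')] out of [(0, 1)] on either side. *)
Lemma diff_bump_far K r e A z z' : (0 < K)%N -> 0 < e ->
  (exists i, r.+1%:R <= `|z ord0 i - z' ord0 i|) ->
  diff_bump K r e A z' (cell_center e z) = 0.
Proof.
move=> K0 e0 [i zi]; rewrite diff_bump_centerE// big1// => k _.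
rewrite (bigD1 i)//= tent0 ?mul0r ?mulr0//.
have k0 : 0 <= k%:R :> R by [].
have kr : k%:R <= r%:R :> R by rewrite ler_nat -ltnS.
move: zi; rewrite -[r.+1%:R]natr1 ler_normr negb_and -!leNgt.
by move=> /orP[zi|zi]; apply/orP; [right|left]; lra.
Qed.

Lemma cube_cell_center e z : 0 < e ->
  (forall i, 0 <= z ord0 i) -> (forall i, (z ord0 i + 1) * e <= 1) ->
  cube (cell_center e z).
Proof.
move=> e0 z0 z1 i; rewrite mxE; apply/andP; split.
  by rewrite mulr_ge0 ?(ltW e0)// addr_ge0.
by apply: le_trans (z1 i); rewrite ler_wpM2r ?(ltW e0)// lerD2l; lra.
Qed.

End diff_bump_norms.
(** The integral of a nonnegative function is a supremum over simple functions below it. Meant for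
    integrands built on [modulus], a supremum over uncountably many steps. *)
Lemma ge0_le_integral_nomeas {d0} {T : measurableType d0} {R : realType}
    (mu : {measure set T -> \bar R}) (D : set T) (f g : T -> \bar R) :
  (forall x, D x -> 0 <= f x)%E -> (forall x, D x -> f x <= g x)%E ->
  (\int[mu]_(x in D) f x <= \int[mu]_(x in D) g x)%E.
Proof.
move=> f0 fg; have g0 x : D x -> (0 <= g x)%E.
  by move=> Dx; exact: le_trans (f0 x Dx) (fg x Dx).
rewrite !ge0_integralE//; apply: le_ereal_sup => _ [h /= hf <-].
exists h => //= x; apply: le_trans (hf x) _; rewrite !patchE.
by case: ifPn => // /set_mem; exact: fg.
Qed.

(** * Moduli of smoothness and the dual Besov norm *)

Section pairing.
Context {R : realType} {d : nat}.
Implicit Types (A e p s L : R) (z y v : 'rV[R]_d) (K r : nat).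
Local Notation lam := (lebesgue_cube R d).

Lemma modulus_ge0 r q (f : 'rV[R]_d -> R) (t : R) : 0 <= t ->
  (0 <= modulus r q f t)%E.
Proof.
move=> t0; apply: le_trans (ereal_sup_ubound _); last first.
  by exists (0 : 'rV[R]_d); rewrite /= ?normr0.
exact: Lnorm_ge0.
Qed.

Lemma modulus_mono r q (f : 'rV[R]_d -> R) (t t' : R) : t <= t' ->
  (modulus r q f t <= modulus r q f t')%E.
Proof.
move=> tt'; apply: le_ereal_sup => _ [v /= vt <-]; exists v => //=.
exact: le_trans tt'.
Qed.

(** The modulus is monotone, so on [[e, 2 e)] the integrand of the seminorm is bounded below through
    its value at [e]; this part of the integral alone is at most 1. *)
Lemma modulus_le_besov s (g : 'rV[R]_d -> R) e : 0 < s -> 0 < e -> 2 * e <= 1 ->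
  (besov_pos_norm s 2%:E g <= 1)%E ->
  (modulus (Num.truncn s).+1 2%:E g e <= (Num.sqrt 2 * (2 * e) `^ s)%:E)%E.
Proof.
move=> s0 e0 e1; rewrite /besov_pos_norm; set r := (Num.truncn s).+1.
set I := (\int[_]_(t in _) _)%E => H.
have e20 : 0 < 2 * e by rewrite mulr_gt0.
have I0 : (0 <= I)%E.
  apply: integral_ge0 => t /=; rewrite in_itv/= => /andP[t0 _].
  by rewrite mule_ge0 ?poweR_ge0// lee_fin invr_ge0 ltW.
have {}H : (I `^ 2^-1 <= 1)%E by apply: le_trans H; rewrite leeDr// Lnorm_ge0.
have I1 : (I <= 1)%E.
  clearbody I; move: I I0 H => [i| |]//=; last first.
    by rewrite invr_eq0 pnatr_eq0.
  rewrite !lee_fin => i0 /(ge0_ler_powR (ler0n R 2)).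
  rewrite !nnegrE powR_ge0 ler01 => /(_ isT isT).
  by rewrite -powRrM mulVf// powRr1// powR1.
(* An infinite modulus would dominate every real [w], in particular one above the bound. *)
suff main (w : R) : 0 <= w -> (w%:E <= modulus r 2%:E g e)%E ->
    w <= Num.sqrt 2 * (2 * e) `^ s.
  have := modulus_ge0 r 2%:E g e (ltW e0).
  move: main; case: (modulus _ _ _ _) => [w| |]//.
    by rewrite !lee_fin => mainP w0; exact: mainP.
  set B := _ * _ => mainP _; have B0 : 0 <= B by rewrite mulr_ge0 ?sqrtr_ge0 ?powR_ge0.
  by have := mainP (B + 1); rewrite leey addr_ge0// => /(_ isT isT); rewrite gerDl ler10.
move=> w0 wW.
(* Lower bound of the integrand on [[e, 2 e)]: [t ^ (- s)] and [1 / t] are smallest at [2 e]. *)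
pose c := ((2 * e) `^ (- s) * w) ^+ 2 / (2 * e).
have c0 : 0 <= c by rewrite divr_ge0 ?sqr_ge0 ?ltW.
have cI : (c%:E * e%:E <= I)%E.
  have -> : (c%:E * e%:E = \int[lebesgue_measure]_(t in `[e, (2 * e)%R[) c%:E)%E.
    rewrite integral_cst//= lebesgue_measure_itv/= lte_fin.
    rewrite ltr_pMl// ltr1n -EFinD; congr (_ * _%:E)%E; ring.
  rewrite integral_mkcond /I [leRHS]integral_mkcond.
  apply: ge0_le_integral_nomeas.
    by move=> t _; rewrite patchE; case: ifP => _; rewrite ?lee_fin.
  move=> t _; rewrite !patchE; case: ifPn => [|_]; last first.
    case: ifPn => // /set_mem/=; rewrite in_itv/= => /andP[t0 _].
    by rewrite mule_ge0 ?poweR_ge0// lee_fin invr_ge0 ltW.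
  move=> /set_mem/=; rewrite in_itv/= => /andP[et te].
  have t0 : 0 < t by rewrite (lt_le_trans e0).
  rewrite mem_set /=; last by rewrite in_itv/= t0 (lt_le_trans te).
  rewrite /c EFinM; apply: lee_pmul; rewrite ?lee_fin ?sqr_ge0 ?invr_ge0 ?(ltW e20)//; last first.
    by rewrite lef_pV2 ?posrE// ltW.
  rewrite -powR_mulrn ?mulr_ge0 ?powR_ge0// -poweR_EFin.
  apply: gt0_ler_poweR; rewrite ?in_itv/= ?leey ?andbT ?lee_fin ?mulr_ge0 ?powR_ge0//.
    by rewrite mule_ge0 ?lee_fin ?powR_ge0// modulus_ge0// ltW.
  rewrite EFinM; apply: lee_pmul; rewrite ?lee_fin ?powR_ge0//.
    rewrite !powRN lef_pV2 ?posrE ?powR_gt0//.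
    by rewrite ge0_ler_powR ?nnegrE ?ltW.
  by apply: (le_trans wW); exact: modulus_mono.
have {cI} : c * e <= 1 by rewrite -lee_fin EFinM (le_trans cI).
have -> : c * e = ((2 * e) `^ (- s) * w) ^+ 2 / 2.
  by rewrite /c; field; rewrite gt_eqF.
rewrite ler_pdivrMr// mul1r => cle.
have : (2 * e) `^ (- s) * w <= Num.sqrt 2.
  by rewrite -[leLHS]ger0_norm ?mulr_ge0 ?powR_ge0// -sqrtr_sqr ler_sqrt.
by rewrite powRN ler_pdivrMl ?powR_gt0// mulrC.
Qed.

End pairing.
Section dual_norm.
Context {R : realType} {d : nat}.
Implicit Types (A e p s L : R) (z y v : 'rV[R]_d) (K r : nat).
Local Notation lam := (lebesgue_cube R d).

Let step e : 'rV[R]_d := const_mx e.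

(** Summation by parts: translating the [k]-th term by [k e] moves the shift from the bump to [g].
    The conditions on [z] keep all [r + 1] copies of the bump inside the cube, where Lebesgue
    measure is translation invariant. *)
Lemma integral_diff_bumpM K r e A z (g : 'rV[R]_d -> R) :
  (0 < K)%N -> 0 < e -> 0 <= A ->
  (forall i, 0 <= z ord0 i) -> (forall i, (z ord0 i + r%:R + 1) * e <= 1) ->
  lam.-integrable setT (EFin \o g) ->
  (\int[lam]_y (diff_bump K r e A z y * g y)%:E =
   \int[lam]_y (A * cell_bump K e z y * fdiff r (step e) g y)%:E)%E.
Proof.
move=> K0 e0 A0 z0 z1 ig.
have mg : measurable_fun setT g by apply/measurable_EFinP; exact: measurable_int ig.
pose phi y := A * cell_bump K e z y.
have mphi : measurable_fun setT phi by apply: measurable_funM => //; exact: measurable_cell_bump.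
have phiA y : `|phi y| <= A.
  by rewrite ger0_norm ?mulr_ge0 ?cell_bump_ge0// ler_piMr ?cell_bump_le1.
pose c k : R := (-1) ^+ (r - k) * 'C(r, k)%:R.
pose F k y := phi (y + k%:R *: - step e) * g y.
have mF k : measurable_fun setT (F k).
  apply: measurable_funM => //; apply: measurableT_comp => //.
  exact: measurable_translation.
have iF k : lam.-integrable setT (EFin \o F k).
  apply: (@le_integrable _ _ _ _ _ _ _ (fun y => A%:E * (EFin \o g) y)%E) => //.
  - exact/measurable_EFinP.
  - move=> y _; rewrite /= lee_fin [leLHS]normrM [leRHS]normrM (ger0_norm A0).
    exact: ler_wpM2r (normr_ge0 _) _ _ (phiA _).
  - exact: integrableZl.
have kw k : k%:R *: step e = const_mx (k%:R * e).
  by apply/rowP => i; rewrite !mxE.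
have FS k y : F k (y + const_mx (k%:R * e)) = phi y * g (y + k%:R *: step e).
  by rewrite /F scalerN -kw addrK.
have ke0 k : 0 <= k%:R * e by rewrite mulr_ge0// ltW.
have Fsupp (k : 'I_r.+1) y i : ~~ (k%:R * e <= y ord0 i <= 1) -> F k y = 0.
  apply: contraNeq; rewrite /F mulf_eq0 negb_or => /andP[+ _].
  rewrite /phi mulf_eq0 negb_or => /andP[_ /(cell_bump_neq0 _ _ _ _ K0 e0)/(_ i)].
  rewrite !mxE mulrN => /andP[h1 h2].
  have kr : k%:R * e <= r%:R * e by rewrite ler_wpM2r ?(ltW e0)// ler_nat -ltnS.
  have h0 : 0 <= z ord0 i * e by rewrite mulr_ge0// ltW.
  have := z1 i; rewrite !mulrDl mul1r => h3.
  rewrite mulrDl mul1r in h2.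
  by apply/andP; split; lra.
have IFS (k : 'I_r.+1) : (\int[lam]_y (F k (y + const_mx (k%:R * e)))%:E =
    \int[lam]_y (F k y)%:E)%E.
  apply: (integral_cube_shift (k%:R * e) (EFin \o F k)) => //.
  - by apply/measurable_EFinP; exact: mF.
  - by move=> y i /Fsupp /= ->.
(* The same translation, applied to [|F k|], transfers integrability. *)
have iFS (k : 'I_r.+1) :
    lam.-integrable setT (EFin \o (fun y => F k (y + const_mx (k%:R * e)))).
  apply/integrableP; split.
    by apply/measurable_EFinP; apply: measurableT_comp => //; exact: measurable_translation.
  have /integrableP[_] := iF k; apply: le_lt_trans.
  rewrite le_eqVlt; apply/orP; left; apply/eqP.
  apply: (integral_cube_shift (k%:R * e) (fun y => `|(F k y)%:E|%E)) => //.
  - by apply: measurableT_comp => //; apply/measurable_EFinP; exact: mF.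
  - by move=> y i /Fsupp ->; rewrite abse0.
transitivity (\int[lam]_y (\sum_(k < r.+1) (c k)%:E * (F k y)%:E))%E.
  apply: eq_integral => y _; rewrite /diff_bump -fdiff_iter_delta /fdiff mulr_suml.
  by rewrite -sumEFin; apply: eq_bigr => k _; congr EFin; exact: esym (mulrA _ _ _).
rewrite integral_sum//; last by move=> k; apply: integrableZl => //; exact: iF.
transitivity (\int[lam]_y (\sum_(k < r.+1) (c k)%:E * (F k (y + const_mx (k%:R * e)))%:E))%E.
  rewrite integral_sum//; last by move=> k; apply: integrableZl => //; exact: iFS.
  apply: eq_bigr => k _; rewrite !integralZl//; [|exact: iFS|exact: iF].
  by congr (_ * _)%E; exact: esym (IFS k).
apply: eq_integral => y _; rewrite /fdiff mulr_sumr -sumEFin.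
by apply: eq_bigr => k _; rewrite -EFinM FS /phi; congr EFin; rewrite /c; ring.
Qed.

Lemma measurable_cube : measurable (@cube R d).
Proof.
rewrite (_ : @cube R d = \bigcap_(i in [set: 'I_d])
    (fun y : 'rV[R]_d => y ord0 i) @^-1` [set` `[0, 1]]); last first.
  apply/seteqP; split => y /= H i; first by move=> _; rewrite /= in_itv/=; exact: H.
  by have := H i Logic.I; rewrite /= in_itv.
apply: fin_bigcap_measurable => // i _; rewrite -[X in measurable X]setTI.
exact: measurable_coord.
Qed.

Lemma Lnorm2_cell_bump_le K e A z : (0 < K)%N -> 0 < e -> 0 <= A ->
  ('N[lam]_2%:E[EFin \o (fun y => (A * cell_bump K e z y)%R)] <=
    (A * Num.sqrt (e ^+ d))%:E)%E.
Proof.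
move=> K0 e0 A0; pose B := [set y : 'rV[R]_d |
  forall i, z ord0 i * e < y ord0 i < z ord0 i * e + e].
have mB : measurable B.
  rewrite (_ : B = \bigcap_(i in [set: 'I_d])
    (fun y : 'rV[R]_d => y ord0 i) @^-1` [set` `]z ord0 i * e, z ord0 i * e + e[]); last first.
    apply/seteqP; split => y /= H i; first by move=> _; rewrite /= in_itv/=; exact: H.
    by have := H i Logic.I; rewrite /= in_itv.
  apply: fin_bigcap_measurable => // i _; rewrite -[X in measurable X]setTI.
  exact: measurable_coord.
have ed : 0 <= e ^+ d by rewrite exprn_ge0 ?ltW.
have -> : A * Num.sqrt (e ^+ d) = ((A ^+ 2 * e ^+ d) `^ 2^-1).
  by rewrite powRM ?sqr_ge0// !powR12_sqrt ?sqr_ge0// sqrtr_sqr ger0_norm.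
rewrite unlock -poweR_EFin; apply: gt0_ler_poweR; rewrite ?invr_ge0//.
- by rewrite in_itv/= leey andbT integral_ge0// => y _; exact: poweR_ge0.
- by rewrite in_itv/= leey andbT lee_fin mulr_ge0 ?sqr_ge0.
apply: (@le_trans _ _ (\int[lam]_y ((A ^+ 2)%:E * (\1_B y)%:E))%E).
  apply: ge0_le_integral_nomeas => y _; first exact: poweR_ge0.
  rewrite /= -EFinM lee_fin powR_mulrn// indicE.
  have [->|h] := eqVneq (cell_bump K e z y) 0.
    by rewrite mulr0 normr0 expr0n mulr_ge0 ?sqr_ge0.
  rewrite mem_set; last first.
    by move=> i; have := cell_bump_neq0 _ _ _ _ K0 e0 h i; rewrite mulrDl mul1r.
  rewrite mulr1 ger0_norm ?mulr_ge0 ?cell_bump_ge0// ler_sqr ?nnegrE ?mulr_ge0 ?cell_bump_ge0//.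
  by rewrite ler_piMr ?cell_bump_le1.
rewrite ge0_integralZl//; last 2 first.
- by apply/measurable_EFinP.
- by rewrite lee_fin sqr_ge0.
rewrite integral_indic// setIT [leRHS]EFinM lee_wpmul2l ?lee_fin ?sqr_ge0//.
exact: lebesgue_cube_box_le (ltW e0).
Qed.

Lemma besov_neg_norm_diff_bump K s e A z : (0 < K)%N -> 0 < s -> 0 < e ->
  2 * e <= 1 -> 0 <= A -> let r := (Num.truncn s).+1 in
  (forall i, 0 <= z ord0 i) -> (forall i, (z ord0 i + r%:R + 1) * e <= 1) ->
  (besov_norm (- s) 2%:E (diff_bump K r e A z) <=
    (A * Num.sqrt (e ^+ d) * (Num.sqrt 2 * (2 * e) `^ s))%:E)%E.
Proof.
move=> K0 s0 e0 e1 A0 r z0 z1.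
rewrite /besov_norm ifF; last by apply/negbTE; rewrite -leNgt oppr_le0 ltW.
rewrite opprK /besov_neg_norm hoelder_conjugate2.
apply: ge_ereal_sup => _ [g [mg Hg] <-].
have Ng : ('N[lam]_2%:E[EFin \o g] <= 1)%E.
  by apply: le_trans Hg; rewrite /besov_pos_norm leeDl// poweR_ge0.
have ig : lam.-integrable setT (EFin \o g).
  apply/Lfun1_integrable; apply: Lfun_subset12; first exact: fin_num_measure.
  apply/andP; split; first by rewrite inE.
  by rewrite inE/=; apply: le_lt_trans Ng _; exact: ltry.
rewrite integral_diff_bumpM//.
pose E := [set y | @cube R d y /\ @cube R d (y + r%:R *: step e)].
have mE : measurable E.
  apply: measurableI; first exact: measurable_cube.
  rewrite -[X in measurable X]setTI.
  by apply: (measurable_translation (r%:R *: step e)) => //; exact: measurable_cube.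
pose phi y := A * cell_bump K e z y.
have mphi : measurable_fun setT phi by apply: measurable_funM => //; exact: measurable_cell_bump.
pose G y := \1_E y * fdiff r (step e) g y.
have mG : measurable_fun setT G.
  apply: measurable_funM; first exact: measurable_indic.
  rewrite (_ : fdiff r (step e) g = iter r (delta (step e)) g).
    exact: measurable_iter_delta.
  by apply/funext => y; rewrite fdiff_iter_delta.
(* Where the bump is nonzero, [y] and [y + r e (1, .., 1)] are both in the cube, so the indicator of
   the modulus can be inserted for free. *)
have re : (\int[lam]_y (A * cell_bump K e z y * fdiff r (step e) g y)%:E =
    \int[lam]_y ((phi \* G)%R y)%:E)%E.
  apply: eq_integral => y _; congr EFin; rewrite /= /phi /G.
  have [->|h] := eqVneq (cell_bump K e z y) 0; first by rewrite mulr0 !mul0r.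
  rewrite indicE mem_set ?mul1r//.
  have hy i := cell_bump_neq0 _ _ _ _ K0 e0 h i.
  have re0 : 0 <= r%:R * e by rewrite mulr_ge0// ltW.
  have ze i : 0 <= z ord0 i * e by rewrite mulr_ge0// ltW.
  split => i; have /andP := hy i; have := z1 i; rewrite ?mxE !mulrDl mul1r => h1 [h2 h3];
    have := ze i => h4; apply/andP; split; lra.
rewrite re.
apply: (@le_trans _ _ ('N[lam]_1[EFin \o (phi \* G)%R])%E).
  rewrite Lnorm1; apply: le_abse_integral => //.
  by apply/measurable_EFinP; exact: measurable_funM.
have half2 : (2^-1 + 2^-1 = 1 :> R) by rewrite -div1r -splitr.
have n2 : 0 < 2 :> R by [].
apply: le_trans (@hoelder _ _ _ lam phi G 2 2 mphi mG n2 n2 half2) _.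
rewrite EFinM; apply: lee_pmul; rewrite ?Lnorm_ge0//.
  exact: Lnorm2_cell_bump_le.
(* In the max norm the diagonal step has length exactly [e], so it competes in the modulus at
   [e]. *)
apply: le_trans (modulus_le_besov s g e s0 e0 e1 Hg).
apply: ereal_sup_ubound; exists (step e) => //=.
rewrite [leLHS]/Num.Def.normr/= mx_normrE; apply/bigmax_leP; split; first exact: ltW.
by move=> i _; rewrite mxE gtr0_norm.
Qed.

End dual_norm.
(** * The lower bound *)

Lemma inv_powR {R : realType} (a x : R) : 0 <= a -> a^-1 `^ x = (a `^ x)^-1.
Proof. by move=> a0; rewrite -powR_inv1// -powRrM mulN1r powRN. Qed.

(** Writing [u = ln n] and [rho = n / u], [N] lies between [x] and [2 x] with
    [x = (D rho) ^ (1 / g)]. The divergence is then at most a power [d / (4 g)] of [n], while [N ^ d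
    >= rho ^ (d / g) >= n ^ (d / (2 g))]; the gap absorbs the factor 4. *)
Lemma exists_grid {R : realType} (d r : nat) (p g c2 : R) :
  (0 < d)%N -> 0 < p -> 0 < g -> 0 <= c2 ->
  exists2 c0 : R, 0 < c0 & exists n0 : nat, forall n, (n0 <= n)%N ->
  exists2 N : nat, (0 < N)%N &
    4 * expR (n%:R * (c2 * (r.+1 * N)%:R^-1 `^ g)) <= (N ^ d)%:R /\
    c0 * (n%:R / ln n%:R) `^ (- (p / g)) <= (r.+1 * N)%:R^-1 `^ p.
Proof.
move=> d0 p0 g0 c20.
have dR0 : 0 < d%:R :> R by rewrite ltr0n.
(* Chosen so that [c2 / D <= d / (4 g)]; the summand 1 keeps [D >= 1]. *)
pose D := 1 + 4 * g * c2 / d%:R.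
have D1 : 1 <= D by rewrite lerDl divr_ge0 ?ler0n// !mulr_ge0// ltW.
have D0 : 0 < D by exact: lt_le_trans D1.
pose b := D `^ g^-1.
have b1 : 1 <= b by rewrite -[leLHS](powRr0 D) ler_powR// invr_ge0 ltW.
have b0 : 0 < b by exact: lt_le_trans b1.
have bg : b `^ g = D by rewrite -powRrM mulVf ?gt_eqF// powRr1// ltW.
(* Because [1 / e = (r + 1) N <= 2 (r + 1) b x0]. *)
exists ((2 * r.+1%:R * b) `^ (- p)).
  by rewrite powR_gt0// !mulr_gt0// ltr0n.
(* Beyond 8, [u <= u^2 / 8 <= exp (u / 2)], so [rho] is at least the square root of [n]; the other
   term gives [ln 4 <= d u / (4 g)]. *)
pose U := Num.max 8 (4 * g * ln 4 / d%:R).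
exists (Num.truncn (expR U)).+1 => n nU.
have nR : expR U <= n%:R.
  by rewrite (le_trans (ltW (truncnS_gt _)))// ler_nat.
have n0 : 0 < n%:R :> R by rewrite (lt_le_trans (expR_gt0 U)).
set u := ln n%:R.
have nE : n%:R = expR u by rewrite lnK.
have uU : U <= u by rewrite -ler_expR -nE.
have u8 : 8 <= u by apply: le_trans uU; rewrite le_max lexx.
have u0 : 0 < u by lra.
have ud : ln 4 <= d%:R / (4 * g) * u.
  have : 4 * g * ln 4 / d%:R <= u by apply: le_trans uU; rewrite le_max lexx orbT.
  rewrite ler_pdivrMr// => H; rewrite mulrAC ler_pdivlMr ?mulr_gt0//.
  lra.
pose rho := n%:R / u.
have rho0 : 0 < rho by rewrite divr_gt0.
have rho_ge : expR (u / 2) <= rho.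
  rewrite /rho ler_pdivlMr// [leRHS](_ : _ = expR (u / 2) * expR (u / 2)); last first.
    by rewrite -expRD -splitr.
  rewrite ler_wpM2l ?expR_ge0//.
  have := @expR_ge1Dxn R (u / 2) 1; rewrite divr_ge0 ?(ltW u0)// => /(_ isT).
  apply: le_trans; rewrite expr2 -[1%N.+1`!]/2%N.
  by have := sqr_ge0 (u - 4); rewrite expr2; nra.
have rho1 : 1 <= rho by apply: le_trans rho_ge; rewrite -expR0 ler_expR divr_ge0 ?ltW.
pose x0 := rho `^ g^-1.
have x01 : 1 <= x0 by rewrite -[leLHS](powRr0 rho) ler_powR// invr_ge0 ltW.
have x00 : 0 < x0 by exact: lt_le_trans x01.
have x0g : x0 `^ g = rho by rewrite -powRrM mulVf ?gt_eqF// powRr1// ltW.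
pose x := b * x0.
have x1 : 1 <= x by rewrite -[leLHS]mulr1 ler_pM.
have x_gt0 : 0 < x by exact: lt_le_trans x1.
pose N := (Num.truncn x).+1.
have xN : x <= N%:R by rewrite ltW// truncnS_gt.
have Nx : N%:R <= 2 * x.
  rewrite -[N%:R]natr1; have : (Num.truncn x)%:R <= x by rewrite truncn_le// ltW.
  lra.
have N0 : 0 < N%:R :> R by rewrite ltr0n.
pose e : R := (r.+1 * N)%:R^-1.
have e0 : 0 < e by rewrite invr_gt0 ltr0n.
have ex : e <= x^-1.
  rewrite lef_pV2 ?posrE ?ltr0n// (le_trans xN)// natrM ler_peMl ?ler1n//.
have eg : e `^ g <= (D * rho)^-1.
  apply: (@le_trans _ _ (x^-1 `^ g)).
    by rewrite ge0_ler_powR ?nnegrE ?invr_ge0 ?(ltW g0) ?(ltW e0) ?(ltW x_gt0).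
  by rewrite inv_powR ?(ltW x_gt0)// /x powRM ?(ltW b0) ?(ltW x00)// bg x0g.
exists N => //; rewrite -/e; split.
  have key : n%:R * (c2 * e `^ g) <= d%:R / (4 * g) * u.
    apply: (@le_trans _ _ (n%:R * (c2 * (D * rho)^-1))).
      by rewrite ler_wpM2l ?ler0n// ler_wpM2l.
    have -> : n%:R * (c2 * (D * rho)^-1) = c2 / D * u.
      by rewrite /rho; field; rewrite !gt_eqF.
    rewrite ler_wpM2r ?(ltW u0)// ler_pdivrMr// /D mulrDr mulr1.
    have -> : d%:R / (4 * g) * (4 * g * c2 / d%:R) = c2 by field; rewrite !gt_eqF.
    by rewrite lerDr divr_ge0 ?ler0n// mulr_ge0// ltW.
  apply: (@le_trans _ _ (expR (ln 4 + d%:R / (4 * g) * u))).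
    by rewrite expRD lnK ?posrE// ler_wpM2l// ler_expR.
  apply: (@le_trans _ _ (expR (d%:R / (2 * g) * u))).
    rewrite ler_expR; have -> : d%:R / (2 * g) * u = d%:R / (4 * g) * u + d%:R / (4 * g) * u.
      by field; rewrite gt_eqF.
    by rewrite lerD2r.
  rewrite natrX; apply: (@le_trans _ _ (x0 ^+ d)); last first.
    by rewrite lerXn2r ?nnegrE ?(ltW x00) ?(ltW N0)// (le_trans _ xN)// ler_peMl// ltW.
  rewrite -powR_mulrn ?(ltW x00)// -powRrM.
  have -> : d%:R / (2 * g) * u = (u / 2) * (g^-1 * d%:R) by field; rewrite gt_eqF.
  by rewrite expRM ge0_ler_powR ?nnegrE ?expR_ge0 ?(ltW rho0)// mulr_ge0 ?invr_ge0 ?ler0n// ltW.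
have -> : rho `^ (- (p / g)) = x0 `^ (- p) by rewrite /x0 -powRrM mulrN mulrC.
rewrite -powRM ?mulr_ge0 ?(ltW b0) ?(ltW x00)//.
rewrite powRN inv_powR ?ler0n// lef_pV2 ?posrE ?powR_gt0 ?ltr0n ?mulr_gt0// ?ltr0n//.
rewrite ge0_ler_powR ?nnegrE ?(ltW p0) ?ler0n ?mulr_ge0 ?ler0n ?(ltW b0) ?(ltW x00)//.
rewrite natrM; move: Nx; rewrite /x => Nx.
rewrite -!mulrA mulrCA ler_wpM2l ?ler0n//.
Qed.
Lemma limn_einf_ge {R : realType} (u : nat -> \bar R) (c : \bar R) (n0 : nat) :
  (forall n, (n0 <= n)%N -> (c <= u n)%E) -> (c <= limn_einf u)%E.
Proof.
move=> cu; rewrite limn_einf_lim; apply: lime_ge; first exact: is_cvg_einfs.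
exists n0 => // n /= n0n; apply: le_ereal_inf_tmp => _ [k /= nk <-].
by apply: cu; exact: leq_trans nk.
Qed.

(** * The grid of hypotheses and its separation *)

Section hypotheses.
Context {R : realType} {d : nat}.
Variables (p s : R) (N : nat).
Hypotheses (p0 : 0 < p) (s0 : 0 < s) (d0 : (0 < d)%N) (N0 : (0 < N)%N).

Let K := (Num.truncn p).+2.
Let r := (Num.truncn s).+1.
Let e : R := (r.+1 * N)%:R^-1.

Definition grid_point (f : {ffun 'I_d -> 'I_N}) : 'rV[R]_d :=
  \row_i (f i * r.+1)%:R.

Let e0 : 0 < e. Proof. by rewrite invr_gt0 ltr0n muln_gt0. Qed.

Lemma grid_step_le : 2 * e <= 1.
Proof.
rewrite /e ler_pdivrMr ?ltr0n ?muln_gt0// mul1r ler_nat.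
by rewrite -[2%N]muln1 leq_mul.
Qed.

Lemma grid_point_ge0 f i : 0 <= grid_point f ord0 i.
Proof. by rewrite mxE. Qed.

(** The largest index is [N - 1], and [(N - 1) (r + 1) + r + 1 = (r + 1) N]: the last cell ends
    exactly at 1. *)
Lemma grid_point_le f i : (grid_point f ord0 i + r%:R + 1) * e <= 1.
Proof.
rewrite /e ler_pdivrMr ?ltr0n ?muln_gt0// mul1r mxE -natrD natr1 ler_nat.
by rewrite -addnS -mulSnr mulnC leq_mul2l ltn_ord orbT.
Qed.

Lemma grid_point_far f f' : f != f' ->
  exists i, r.+1%:R <= `|grid_point f ord0 i - grid_point f' ord0 i|.
Proof.
move=> ff'; have [i fi] : exists i, f i != f' i.
  apply/existsP; apply: contraNT ff'; rewrite negb_exists => /forallP H.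
  by apply/eqP/ffunP => i; apply/eqP; have := H i; rewrite negbK.
exists i; rewrite !mxE.
wlog lt : f f' ff' fi / (f i < f' i)%N => [H|].
  have : f i != f' i :> nat by [].
  rewrite neq_ltn => /orP[h|h]; first exact: H.
  by rewrite distrC; apply: H => //; rewrite eq_sym.
rewrite distrC ger0_norm ?subr_ge0 ?ler_nat ?leq_mul2r ?(ltnW lt) ?orbT//.
rewrite -natrB ?leq_mul2r ?(ltnW lt) ?orbT// ler_nat -mulnBl.
by rewrite leq_pmull// subn_gt0.
Qed.

Lemma cube_grid_center f : cube (cell_center e (grid_point f)).
Proof.
apply: cube_cell_center => // i; first exact: grid_point_ge0.
apply: le_trans (grid_point_le f i); rewrite ler_wpM2r ?(ltW e0)//.
by rewrite lerD2r lerDl.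
Qed.

(** A single point separates two hypotheses: at the center attached to [f], one bump has modulus
    [A * tent K K 2^-1 ^+ d] and the other vanishes. *)
Lemma sup_dist_diff_bump A f f' (g : 'rV[R]_d -> R) (t : R) :
  0 <= A -> f != f' -> t + t <= A * tent K K 2^-1 ^+ d ->
  (sup_dist (diff_bump K r e A (grid_point f)) g < t%:E)%E ->
  (sup_dist (diff_bump K r e A (grid_point f')) g < t%:E)%E -> False.
Proof.
move=> A0 ff' tA H1 H2; set y := cell_center e (grid_point f).
have H h : (sup_dist h g < t%:E)%E -> `|h y - g y| < t.
  rewrite -lte_fin; apply: le_lt_trans; apply: ereal_sup_ubound.
  by exists y => //; exact: cube_grid_center.
have {H1} := H _ H1; have {H2} := H _ H2.
rewrite (diff_bump_far _ _ _ _ (grid_point f) (grid_point f'))//; last exact: grid_point_far.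
rewrite sub0r normrN => h1 h2.
have := diff_bump_center K r e A (grid_point f) d0 isT e0 A0.
rewrite -/y => E; rewrite -E in tA.
have := ler_normD (diff_bump K r e A (grid_point f) y - g y) (g y).
by rewrite subrK => h3; lra.
Qed.

End hypotheses.
(** Origin of the rate exponent: [2 p] from the height, [d] from the volume of the cell, [2 s] from
    the duality. *)
Lemma sqr_dual_bound {R : realType} (d : nat) (C a p s e : R) : 0 < e ->
  (C * (a * e `^ p * Num.sqrt (e ^+ d) * (Num.sqrt 2 * (2 * e) `^ s))) ^+ 2 =
  C ^+ 2 * a ^+ 2 * 2 * 2 `^ (2 * s) * e `^ (2 * (p + s) + d%:R).
Proof.
move=> e0; have eX : e != 0 by rewrite gt_eqF.
have sqr_powR (x y : R) : (x `^ y) ^+ 2 = x `^ (2 * y).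
  by rewrite -powR_mulrn ?powR_ge0// -powRrM mulrC.
rewrite !exprMn !sqr_powR !sqr_sqrtr ?exprn_ge0 ?(ltW e0)//.
rewrite powRM ?(ltW e0)// -powR_mulrn ?(ltW e0)//.
rewrite powRD ?eX ?implybT// [2 * (p + s)]mulrDr powRD ?eX ?implybT//.
ring.
Qed.

Theorem theorem3p3 (R : realType) (d : nat) (p L s sigma0 : R) :
  (0 < d)%N -> 0 < p -> 0 < L -> 0 < s -> 0 < sigma0 ->
  exists2 c' : R, 0 < c' &
  forall C : R, 0 < C ->
  exists2 c : R, 0 < c &
  forall (k : nat) (d0 : measure_display) (Omega : measurableType d0)
    (Pr : probability Omega R)
    (X : {RV Pr >-> 'rV[R]_k}) (Y2 : {RV Pr >-> 'rV[R]_d})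
    (T : ('rV[R]_d -> R) -> ('rV[R]_k -> R))
    (sigma2 : 'rV[R]_k -> R)
    (P : ('rV[R]_d -> R) -> probability (R * 'rV[R]_k)%type R),
  law_support (distribution Pr Y2) = @cube R d ->
  is_cond_expectation X Y2 T ->
  measurable_fun setT sigma2 ->
  (forall x, sigma0 ^+ 2 <= sigma2 x) ->
  (forall h, holder_ball p L h ->
     is_npir_law (distribution Pr X) (T h) sigma2 (P h)) ->
  (forall h, holder_ball p L h ->
     ('N[distribution Pr X]_2%:E[EFin \o T h]
       <= C%:E * besov_norm (- s) 2%:E h)%E) ->
  (c'%:E <= limn_einf (fun n : nat =>
     ereal_inf [set
       ereal_sup [set
         iid (P h) n [set z | (c * (n%:R / ln n%:R)
                                 `^ (- (p / (2 * (p + s) + d%:R))))%:E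
                              <= sup_dist h (hhat z)]%E
       | h in holder_ball p L]
     | hhat in @estimator R k d n p L]))%E.
Proof.
move=> d_gt0 p0 L0 s0 sg0; exists 2^-1 => // C C0.
pose r := (Num.truncn s).+1; pose K := (Num.truncn p).+2.
have [a1 a10 Hball] := @diff_bump_holder_ball R d p L r p0 L0.
(* [a1] keeps the bumps in the Hoelder ball; the second term keeps
   [|h| <= 2 ^ r * A <= sigma0 / 2]. *)
pose a := Num.min a1 (sigma0 / (2 * 2 ^+ r)).
have r20 : 0 < 2 ^+ r :> R by rewrite exprn_gt0.
have a0 : 0 < a by rewrite lt_min a10 divr_gt0// mulr_gt0.
have aa1 : a <= a1 by rewrite ge_min lexx.
have asg : 2 ^+ r * a <= sigma0 / 2.
  have : a <= sigma0 / (2 * 2 ^+ r) by rewrite ge_min lexx orbT.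
  by rewrite invfM mulrA ler_pdivlMr// mulrC.
pose kap : R := tent K K 2^-1 ^+ d.
have kap0 : 0 < kap.
  by rewrite exprn_gt0// tent_gt0// invr_gt0 ltr0n/= invf_lt1 ?ltr1n.
pose g := 2 * (p + s) + d%:R.
have g0 : 0 < g by rewrite addr_gt0 ?ltr0n// mulr_gt0// addr_gt0.
(* By [sqr_dual_bound], the log-divergence of one observation is [c2 * e ^ g]. *)
pose c2 := 2 / sigma0 ^+ 2 * (C ^+ 2 * a ^+ 2 * 2 * 2 `^ (2 * s)).
have c20 : 0 <= c2.
  rewrite mulr_ge0 ?divr_ge0 ?sqr_ge0// mulr_ge0 ?powR_ge0// mulr_ge0//.
  by rewrite mulr_ge0 ?sqr_ge0.
have [c0 c00 [n0 Hn]] := @exists_grid R d r p g c2 d_gt0 p0 g0 c20.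
(* The half leaves room for two balls of radius [t] within the separation [kap * A]. *)
exists (kap * a * c0 / 2); first by rewrite divr_gt0// !mulr_gt0.
move=> k d0 Omega Pr X Y2 T sigma2 P _ HT ms hs HP HN.
apply: (@limn_einf_ge _ _ _ n0) => n nn0.
have [N N0 [HK Hrate]] := Hn n nn0.
apply: le_ereal_inf_tmp => _ [hhat est <-].
set t := _ * _ `^ _; pose e : R := (r.+1 * N)%:R^-1.
have e0 : 0 < e by rewrite invr_gt0 ltr0n muln_gt0.
have e2 : 2 * e <= 1 by exact: grid_step_le.
have e01 : 0 < e <= 1 by rewrite e0/=; lra.
pose A := a * e `^ p.
have A0 : 0 <= A by rewrite mulr_ge0 ?powR_ge0 ?ltW.
have Aa : A <= a.
  rewrite ler_piMr ?(ltW a0)//; case/andP: e01 => _ e1.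
  by have := @ge0_ler_powR R p (ltW p0) e 1; rewrite !nnegrE powR1 => ->//; exact: ltW.
pose h (f : {ffun 'I_d -> 'I_N}) := diff_bump K r e A (grid_point s N f).
have hball f : holder_ball p L (h f).
  by apply: Hball => //; rewrite A0/= ler_wpM2r ?powR_ge0.
(* The null hypothesis is a bump of height 0. *)
have ball0 : holder_ball p L (cst 0 : 'rV[R]_d -> R).
  have <- : diff_bump K r e 0 (0 : 'rV[R]_d) = cst 0.
    by apply/funext => y; rewrite /diff_bump iter_deltaZ mul0r.
  by apply: Hball; rewrite // lexx mulr_ge0 ?powR_ge0 ?(ltW a10).
pose B := C * (A * Num.sqrt (e ^+ d) * (Num.sqrt 2 * (2 * e) `^ s)).
have B0 : 0 <= B by rewrite !mulr_ge0 ?sqrtr_ge0 ?powR_ge0 ?(ltW C0) ?(ltW a0).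
have hchi f : chi2_bound (expR (2 / sigma0 ^+ 2 * B ^+ 2)) (P (h f)) (P (cst 0)).
  apply: (chi2_bound_cond_expectation Pr X Y2 T sigma2 _ _ (h f) sigma0 (2 ^+ r * A)) => //.
  - exact: measurable_diff_bump.
  - by rewrite mulr_ge0 ?(ltW r20)//= (le_trans _ asg)// ler_wpM2l ?(ltW r20).
  - by move=> y; exact: diff_bump_le.
  - apply: (le_trans (HN _ (hball f))); rewrite /B EFinM.
    apply: lee_wpmul2l; first by rewrite lee_fin ltW.
    apply: besov_neg_norm_diff_bump => // i.
    + exact: grid_point_ge0.
    + exact: grid_point_le.
  - exact: HP.
  - exact: HP.
have chin f := chi2_bound_iid _ _ _ n (expR_ge0 _) (hchi f).
pose E f := [set z | (sup_dist (h f) (hhat z) < t%:E)%E].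
have mE f : measurable (E f).
  rewrite -[E f]setTI; have := est _ (hball f) => ms'.
  exact: (emeasurable_fun_infty_o measurableT ms').
have tE : trivIset setT E.
  apply/trivIsetP => f f' _ _ ff'; apply/seteqP; split => // z [Ez Ez'].
  apply: (@sup_dist_diff_bump R d p s N d_gt0 N0 A f f' (hhat z) t A0 ff') => //.
  rewrite -/kap /t /A -/g.
  have : kap * a * (c0 * (n%:R / ln n%:R) `^ (- (p / g))) <= kap * a * e `^ p.
    by rewrite ler_wpM2l// mulr_ge0// ltW.
  by move: ((_ / _) `^ _) => q; lra.
have [||f Hf] := @exists_error_ge _ _ R {ffun 'I_d -> 'I_N}
  (expR (2 / sigma0 ^+ 2 * B ^+ 2) ^+ n) (fun f => iid (P (h f)) n)
  (iid (P (cst 0)) n) E _ mE tE chin.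
- by rewrite card_ffun !card_ord expn_gt0 N0.
(* There are [N ^ d] hypotheses, so the counting condition is the first property of the grid. *)
- rewrite card_ffun !card_ord -expRM_natl /B /A sqr_dual_bound// [X in n%:R * X]mulrA.
  exact: HK.
apply: le_trans Hf _; apply: ereal_sup_ubound; exists (h f) => //.
congr (iid _ _ _); apply/seteqP; split => z /= H.
  by apply/negP; rewrite -leNgt.
by move/negP: H; rewrite -leNgt.
Qed.
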